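(* Let $R$ be a skew-invertible even Hecke symmetry of bi-rank $(m|0)$. In the Yangian of RTT type $\mathbf{Y}_{RTT}(R)$ the determinant $$e_m(u)=\mathrm{Tr}_{R(1\dots m)}\Big(\mathcal{P}^{(m)}_{1\dots m}T_1(u)T_2(q^{-2}u)\cdots T_m(q^{-2(m-1)}u)\Big)$$ is central (i.e. all its Laurent coefficients are central in $\mathbf{Y}_{RTT}(R)$) if and only if the $N\times N$ matrix $\mathcal{N}$ with entries $$\mathcal{N}_i^j=(-1)^{m-1}q\,m_q\,\mathsf{u}_{i a_1\dots a_{m-1}}\mathsf{v}^{a_1\dots a_{m-1}j}$$ is scalar (a multiple of the identity matrix).
   Context: Conventions. $V$ is an $N$-dimensional vector space over $\mathbb{K}=\mathbb{R}$ or $\mathbb{C}$ with a fixed basis $\{x_i\}$. An operator $R$ on $V^{\otimes 2}$ has matrix given by $R(x_i\otimes x_j)=R_{ij}^{ks}x_k\otimes x_s$ (summation over repeated indices); matrix products are $(AB)_i^j=A_i^kB_k^j$. $R_k=R_{k\,k+1}$ is $R$ acting in tensor factors $k,k+1$; $T_k$ is the matrix $T$ placed in the $k$-th tensor factor. Hecke symmetry: $R$ satisfies $R_{12}R_{23}R_{12}=R_{23}R_{12}R_{23}$ and $(qI-R)(q^{-1}I+R)=0$, with $q\in\mathbb{K}$ nonzero and generic ($q^n\neq 1$ for all nonzero integers $n$). Put $k_q=\frac{q^k-q^{-k}}{q-q^{-1}}$. Skew-invertible: there is $\Psi$ on $V^{\otimes 2}$ with $R_{ij}^{kl}\Psi_{lp}^{jq'}=\delta_i^{q'}\delta_p^k$.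 Put $C_i^j=\Psi_{ik}^{jk}$; $\mathrm{Tr}_R(X)=\mathrm{Tr}(XC)=C_i^jX_j^i$, and $\mathrm{Tr}_{R(1\dots k)}$ is the $R$-trace over tensor factors $1,\dots,k$. Skew-symmetrizers: $\mathcal{P}^{(1)}=I$, $\mathcal{P}^{(k+1)}_{1\dots k+1}=\frac{k_q}{(k+1)_q}\mathcal{P}^{(k)}_{1\dots k}\big(\frac{q^k}{k_q}I-R_k\big)\mathcal{P}^{(k)}_{1\dots k}$. $R$ is even of bi-rank $(m|0)$, $m\ge2$, if $\mathcal{P}^{(m)}\neq0$ and $\mathcal{P}^{(k)}=0$ for all $k>m$. In this case it is known that $\mathcal{P}^{(m)}$ has rank one, so $\mathcal{P}^{(m)}(x_{i_1}\otimes\dots\otimes x_{i_m})=\mathsf{u}_{i_1\dots i_m}\mathsf{v}^{j_1\dots j_m}x_{j_1}\otimes\dots\otimes x_{j_m}$ with $\mathsf{u}_{i_1\dots i_m}\mathsf{v}^{i_1\dots i_m}=1$ ($\mathsf{u},\mathsf{v}$ are defined up to $\mathsf u\to\lambda\mathsf u$, $\mathsf v\to\lambda^{-1}\mathsf v$). Yangian of RTT type: with $R(u,v)=R-\frac{u(q-q^{-1})}{u-v}I$, $\mathbf{Y}_{RTT}(R)$ is the unital associative algebra generated by the entries of the matrices $T[k]$, $k\ge0$, where $T(u)=\sum_{k\ge0}T[k]u^{-k}$ ($T[0]$ is not required to be $I$), subject to the relations obtained by expanding $R(u,v)T_1(u)T_2(v)=T_1(v)T_2(u)R(u,v)$. 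*)

(* Defs.v *)
From HB Require Import structures.
From mathcomp Require Import all_boot all_order all_algebra.
From mathcomp Require Import generic_quotient boolp reals complex monalg.

Set Implicit Arguments.
Unset Strict Implicit.
Unset Printing Implicit Defensive.

Import GRing.Theory.

Local Open Scope ring_scope.
Local Open Scope quotient_scope.

(* Operators on the n-th tensor power of an N-dimensional space, with entries
   in A: square matrices indexed by the multi-indices (i_1, ..., i_n), through
   their enumeration. Rows carry the lower indices and columns the upper ones,
   X (x_I) = \sum_J X_I^J x_J, so that mulmx is (AB)_I^J = A_I^K B_K^J. *)
Notation tensor_op A N n := 'M[A]_(#|{: n.-tuple 'I_N}|).

Definition coef (A : Type) (N n : nat) (X : tensor_op A N n)
    (a b : n.-tuple 'I_N) : A := X (enum_rank a) (enum_rank b).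

Definition tensor_mx (A : Type) (N n : nat)
    (f : n.-tuple 'I_N -> n.-tuple 'I_N -> A) : tensor_op A N n :=
  \matrix_(a, b) f (enum_val a) (enum_val b).

(* X acting in the tensor factors s_1, ..., s_p of n factors, in this order
   (s is meant to have distinct entries), and the identity elsewhere. *)
Definition place (A : nmodType) (N n p : nat) (s : p.-tuple 'I_n)
    (X : tensor_op A N p) : tensor_op A N n :=
  tensor_mx (fun a b =>
    if [forall l, (l \notin s) ==> (tnth a l == tnth b l)]
    then coef X (map_tuple (tnth a) s) (map_tuple (tnth b) s) else 0).

Definition place1 (A : nmodType) (N n : nat) (k : 'I_n) (X : 'M[A]_N) :
    tensor_op A N n :=
  tensor_mx (fun a b =>
    if [forall l, (l != k) ==> (tnth a l == tnth b l)]
    then X (tnth a k) (tnth b k) else 0).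

Section HeckeSymmetry.

Context {K : fieldType} {N : nat}.
Implicit Types (q : K) (R Psi : tensor_op K N 2) (m n k : nat).

Definition generic q : Prop :=
  q != 0 /\ forall n : int, n != 0 -> q ^ n != 1.

(* [k]_q *)
Definition qnum q k : K := (q ^+ k - q ^- k) / (q - q^-1).

(* R in the factors k and k+1 (counted from 0) of n+1 factors, for k < n *)
Definition adjacent n k R : tensor_op K N n.+1 :=
  place [tuple inord k; inord k.+1] R.

Definition hecke_symmetry q R : Prop :=
  adjacent 2 0 R *m adjacent 2 1 R *m adjacent 2 0 R
    = adjacent 2 1 R *m adjacent 2 0 R *m adjacent 2 1 R
  /\ (q%:M - R) *m (q^-1%:M + R) = 0.

(* Psi is unique when it exists: the partial transposes of R and Psi are
   inverse matrices of size N^2. *)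
Definition skew_inverse R Psi : Prop :=
  forall i k p r : 'I_N,
    \sum_(j < N) \sum_(l < N)
      coef R [tuple i; j] [tuple k; l] * coef Psi [tuple l; p] [tuple j; r]
    = ((i == r) && (p == k))%:R.

Definition Cmx Psi : 'M[K]_N :=
  \matrix_(i, j) \sum_(k < N) coef Psi [tuple i; k] [tuple j; k].

(* P^(k) on k factors; the value at k = 0 is irrelevant. *)
Fixpoint skew_symmetrizer q R k : tensor_op K N k :=
  match k with
  | 0 => 1%:M
  | j.+1 =>
      match j return tensor_op K N j -> tensor_op K N j.+1 with
      | 0 => fun _ => 1%:M
      | i.+1 => fun P =>
          let j := i.+1 in
          let Pj := place [tuple widen_ord (leqnSn j) l | l < j] P in
          (qnum q j / qnum q j.+1) *:
            (Pj *m ((q ^+ j / qnum q j)%:M - adjacent j i R) *m Pj)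
      end (skew_symmetrizer q R j)
  end.

Definition even_birank q R m : Prop :=
  skew_symmetrizer q R m <> 0
  /\ forall k, (m < k)%N -> skew_symmetrizer q R k = 0.

Definition rank_one_factors q R m (u v : m.-tuple 'I_N -> K) : Prop :=
  (forall a b, coef (skew_symmetrizer q R m) a b = u a * v b)
  /\ \sum_(a : m.-tuple 'I_N) u a * v a = 1.

(* The condition forces a = (i, a_1, ..., a_(m-1)) and
   b = (a_1, ..., a_(m-1), j). *)
Definition Nmx q m (u v : m.-tuple 'I_N -> K) : 'M[K]_N :=
  \matrix_(i, j) ((-1) ^+ m.-1 * q * qnum q m *
    \sum_(a : m.-tuple 'I_N)
      \sum_(b : m.-tuple 'I_N | rcons a j == i :: b) u a * v b).

End HeckeSymmetry.

Section OverAlgebra.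

Context {K : fieldType} {N : nat} {A : lalgType K}.

Definition scal_mx (p r : nat) (X : 'M[K]_(p, r)) : 'M[A]_(p, r) :=
  map_mx (in_alg A) X.

(* The R-trace over all of the n factors, Tr (X C_1 ... C_n) *)
Definition Rtrace (Psi : tensor_op K N 2) (n : nat) (X : tensor_op A N n) : A :=
  \tr (X *m scal_mx (\prod_(k < n) place1 k (Cmx Psi))).

(* Difference of the coefficients of u^-k v^-l in the two sides of
   R(u,v) T_1(u) T_2(v) = T_1(v) T_2(u) R(u,v), where
   R(u,v) = R - (q - q^-1) \sum_(r >= 0) u^-r v^r.
   For l < 0 these coefficients are equal whatever T is, so that nothing is
   lost by taking l in nat; the expansion of u / (u - v) in powers of u / v
   yields the same relations, as T_1(u) T_2(v) - T_1(v) T_2(u) is divisible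
   by u - v. *)
Definition rtt_coef (q : K) (R : tensor_op K N 2) (T : nat -> 'M[A]_N)
    (k l : nat) : tensor_op A N 2 :=
  let T1 j := place1 (ord0 : 'I_2) (T j) in
  let T2 j := place1 (ord_max : 'I_2) (T j) in
  let h := (q - q^-1)%:A in
  (scal_mx R *m T1 k *m T2 l
     - h *: \sum_(r < k.+1) T1 (k - r)%N *m T2 (l + r)%N)
  - (T1 l *m T2 k *m scal_mx R
     - h *: \sum_(r < k.+1) T1 (l + r)%N *m T2 (k - r)%N).

(* Coefficient of u^-n in
   Tr_R (P^(m) T_1(u) T_2(q^-2 u) ... T_m(q^(-2(m-1)) u)),
   where T_(i+1)(q^(-2i) u) = \sum_k q^(2ik) T_(i+1)[k] u^-k. *)
Definition det_coef (q : K) (R Psi : tensor_op K N 2) (T : nat -> 'M[A]_N)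
    (m n : nat) : A :=
  \sum_(d : {ffun 'I_m -> 'I_n.+1} | (\sum_(i < m) d i)%N == n)
    Rtrace Psi (scal_mx (skew_symmetrizer q R m) *m
      \prod_(i < m) ((q ^+ (2 * i * d i))%:A *: place1 i (T (d i)))).

Lemma rtt_coef_eq0 (f : {rmorphism A -> K}) (T : nat -> 'M[A]_N) :
  (forall k i j, f (T k i j) = 0) ->
  forall q R k l a b, f (rtt_coef q R T k l a b) = 0.
Proof.
move=> fT0 q R k l a b.
have fT n (i : 'I_n) j c d : f (place1 i (T j) c d) = 0.
  by rewrite mxE; case: ifP => _; [apply: fT0 | apply: raddf0].
have fTT n (i j : 'I_n) c d s t :
    f ((place1 i (T c) *m place1 j (T d)) s t) = 0.
  by rewrite mxE rmorph_sum big1 // => e _; rewrite rmorphM fT mul0r.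
have fS h (F : 'I_k.+1 -> tensor_op A N 2) :
    (forall r, f (F r a b) = 0) -> f ((h *: \sum_(r < k.+1) F r) a b) = 0.
  by move=> HF; rewrite mxE rmorphM summxE rmorph_sum [X in _ * X]big1 ?mulr0.
have fL (X : tensor_op A N 2) i j c d :
    f ((X *m place1 i (T c) *m place1 j (T d)) a b) = 0.
  by rewrite mxE rmorph_sum big1 // => e _; rewrite rmorphM fT mulr0.
have fR (X : tensor_op A N 2) i j c d :
    f ((place1 i (T c) *m place1 j (T d) *m X) a b) = 0.
  by rewrite mxE rmorph_sum big1 // => e _; rewrite rmorphM fTT mul0r.
have E (X Y Z W : tensor_op A N 2) :
    ((X - Y) - (Z - W)) a b = (X a b - Y a b) - (Z a b - W a b).
  by rewrite !mxE.
by rewrite /rtt_coef E !rmorphB fL fR !fS ?subrr.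
Qed.

End OverAlgebra.

Section Yangian.

Context {K : fieldType} {N : nat} (q : K) (R : tensor_op K N 2).

(* The free algebra on the letters (k, i, j), standing for T[k]_i^j *)
Local Notation free_alg := {malg K[{fmonom (nat * 'I_N * 'I_N)%type}]}.

Definition free_T (k : nat) : 'M[free_alg]_N :=
  \matrix_(i, j) << fmu (k, i, j) >>.

(* The two-sided ideal generated by the RTT relations *)
Inductive rtt_ideal : free_alg -> Prop :=
| rtt_rel k l a b : rtt_ideal (rtt_coef q R free_T k l a b)
| rtt_ideal0 : rtt_ideal 0
| rtt_idealD x y : rtt_ideal x -> rtt_ideal y -> rtt_ideal (x + y)
| rtt_idealMl z x : rtt_ideal x -> rtt_ideal (z * x)
| rtt_idealMr z x : rtt_ideal x -> rtt_ideal (x * z).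

Definition rtt_equiv (x y : free_alg) : bool := `[< rtt_ideal (x - y) >].

Lemma rtt_idealN x : rtt_ideal x -> rtt_ideal (- x).
Proof. by rewrite -mulN1r; apply: rtt_idealMl. Qed.

Lemma rtt_equiv_is_equiv : equiv_class_of rtt_equiv.
Proof.
split=> [x|x y|y x z].
- by apply/asboolP; rewrite subrr; apply: rtt_ideal0.
- by apply/asboolP/asboolP => /rtt_idealN; rewrite opprB.
- move=> /asboolP Hxy /asboolP Hyz; apply/asboolP.
  by rewrite -(subrK y x) -addrA; apply: rtt_idealD.
Qed.

Canonical rtt_equiv_equiv := EquivRelPack rtt_equiv_is_equiv.
Canonical rtt_equiv_encModRel := defaultEncModRel rtt_equiv.

Definition yangian := {eq_quot rtt_equiv}.

HB.instance Definition _ : EqQuotient free_alg rtt_equiv yangian :=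
  EqQuotient.on yangian.
HB.instance Definition _ := Choice.on yangian.

Lemma yangian_eqP (x y : free_alg) :
  reflect (rtt_ideal (x - y)) (x == y %[mod yangian]).
Proof. by rewrite eqmodE; apply: asboolP. Qed.

Definition yzero : yangian := lift_cst yangian 0.
Definition yadd := lift_op2 yangian +%R.
Definition yopp := lift_op1 yangian -%R.
Definition yone : yangian := lift_cst yangian 1.
Definition ymul := lift_op2 yangian *%R.
Definition yscale (c : K) := lift_op1 yangian ( *:%R c).

Canonical pi_yzero_morph := PiConst yzero.
Canonical pi_yone_morph := PiConst yone.

Lemma pi_yopp : {morph \pi : x / - x >-> yopp x}.
Proof.
move=> x; unlock yopp; apply/eqP/yangian_eqP.
rewrite -opprD; apply: rtt_idealN; apply/yangian_eqP.
by rewrite reprK.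
Qed.
Canonical pi_yopp_morph := PiMorph1 pi_yopp.

Lemma pi_yadd : {morph \pi : x y / x + y >-> yadd x y}.
Proof.
move=> x y; unlock yadd; apply/eqP/yangian_eqP.
rewrite opprD addrACA; apply: rtt_idealD;
  by apply/yangian_eqP; rewrite reprK.
Qed.
Canonical pi_yadd_morph := PiMorph2 pi_yadd.

Lemma pi_ymul : {morph \pi : x y / x * y >-> ymul x y}.
Proof.
move=> x y; unlock ymul; apply/eqP/yangian_eqP.
set x' := repr _; set y' := repr _.
have -> : x * y - x' * y' = x * (y - y') + (x - x') * y'.
  by rewrite mulrBr mulrBl addrA subrK.
by apply: rtt_idealD; [apply: rtt_idealMl | apply: rtt_idealMr];
  apply/yangian_eqP; rewrite reprK.
Qed.
Canonical pi_ymul_morph := PiMorph2 pi_ymul.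

Lemma pi_yscale c : {morph \pi : x / c *: x >-> yscale c x}.
Proof.
move=> x; unlock yscale; apply/eqP/yangian_eqP.
rewrite -scalerBr -mul_malgC; apply: rtt_idealMl; apply/yangian_eqP.
by rewrite reprK.
Qed.
Canonical pi_yscale_morph c := PiMorph1 (pi_yscale c).

Lemma yaddA : associative yadd.
Proof.
by move=> x y z; rewrite -[x]reprK -[y]reprK -[z]reprK !piE addrA.
Qed.
Lemma yaddC : commutative yadd.
Proof. by move=> x y; rewrite -[x]reprK -[y]reprK !piE addrC. Qed.
Lemma yadd0 : left_id yzero yadd.
Proof. by move=> x; rewrite -[x]reprK !piE add0r. Qed.
Lemma yaddN : left_inverse yzero yopp yadd.
Proof. by move=> x; rewrite -[x]reprK !piE addNr. Qed.

HB.instance Definition _ := GRing.isZmodule.Build yangian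
  yaddA yaddC yadd0 yaddN.

Lemma ymulA : associative ymul.
Proof.
by move=> x y z; rewrite -[x]reprK -[y]reprK -[z]reprK !piE mulrA.
Qed.
Lemma ymul1l : left_id yone ymul.
Proof. by move=> x; rewrite -[x]reprK !piE mul1r. Qed.
Lemma ymul1r : right_id yone ymul.
Proof. by move=> x; rewrite -[x]reprK !piE mulr1. Qed.
Lemma ymulDl : left_distributive ymul yadd.
Proof.
by move=> x y z; rewrite -[x]reprK -[y]reprK -[z]reprK !piE mulrDl.
Qed.
Lemma ymulDr : right_distributive ymul yadd.
Proof.
by move=> x y z; rewrite -[x]reprK -[y]reprK -[z]reprK !piE mulrDr.
Qed.

(* All relations are quadratic, so that the constant term vanishes on the
   ideal and 1 does not belong to it. *)
Lemma rtt_ideal_mcoeff1 x : rtt_ideal x -> x@_mone = 0.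
Proof.
elim=> [k l a b||y z _ Hy _ Hz|z y _ Hy|z y _ Hy].
- apply: rtt_coef_eq0 => j c d; rewrite mxE [LHS]mcoeffU1.
  by case: eqP => // /(congr1 (@fdeg _)); rewrite /fdeg fmU fm1.
- exact: mcoeff0.
- by rewrite mcoeffD Hy Hz addr0.
- by rewrite (mcoeff1g_is_multiplicative _ _).1 Hy mulr0.
- by rewrite (mcoeff1g_is_multiplicative _ _).1 Hy mul0r.
Qed.

Lemma yone_neq0 : yone != yzero.
Proof.
rewrite !piE; apply/negP => /asboolP; rewrite subr0 => /rtt_ideal_mcoeff1.
by rewrite mcoeff1 eqxx; apply/eqP; rewrite oner_neq0.
Qed.

HB.instance Definition _ := GRing.Zmodule_isNzRing.Build yangian
  ymulA ymul1l ymul1r ymulDl ymulDr yone_neq0.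

Lemma yscaleA a b x : yscale a (yscale b x) = yscale (a * b) x.
Proof. by rewrite -[x]reprK !piE scalerA. Qed.
Lemma yscale1 : left_id 1 yscale.
Proof. by move=> x; rewrite -[x]reprK !piE scale1r. Qed.
Lemma yscaleDr : right_distributive yscale +%R.
Proof.
by move=> a x y; rewrite -[x]reprK -[y]reprK -[+%R]/yadd !piE scalerDr.
Qed.
Lemma yscaleDl x : {morph yscale^~ x : a b / a + b}.
Proof.
by move=> a b; rewrite /= -[x]reprK -[+%R in RHS]/yadd !piE scalerDl.
Qed.

HB.instance Definition _ := GRing.Zmodule_isLmodule.Build K yangian
  yscaleA yscale1 yscaleDr yscaleDl.

Lemma yscaleAl (a : K) (x y : yangian) : a *: (x * y) = (a *: x) * y.
Proof.
rewrite -[x]reprK -[y]reprK -[*%R]/ymul -[ *:%R]/yscale !piE.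
by rewrite scalerAl.
Qed.

HB.instance Definition _ := GRing.Lmodule_isLalgebra.Build K yangian yscaleAl.

Lemma free_scaleAr (a : K) (x y : free_alg) : a *: (x * y) = x * (a *: y).
Proof.
have C : a%:MP * x = x * a%:MP :> free_alg.
  rewrite !malgM_def fgmulUg fgmulgU; apply: eq_bigr => k _.
  by rewrite mul1m mulm1 mulrC.
by rewrite -[LHS]mul_malgC -(mul_malgC a y) mulrA C -mulrA.
Qed.

Lemma yscaleAr (a : K) (x y : yangian) : a *: (x * y) = x * (a *: y).
Proof.
rewrite -[x]reprK -[y]reprK -[*%R]/ymul -[ *:%R]/yscale !piE.
by rewrite free_scaleAr.
Qed.

HB.instance Definition _ := GRing.Lalgebra_isAlgebra.Build K yangian yscaleAr.

Definition yangian_T (k : nat) : 'M[yangian]_N :=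
  \matrix_(i, j) \pi_yangian (free_T k i j).

End Yangian.

Arguments yangian {K N} q R.
Arguments yangian_T {K N} q R k.

Definition central (A : pzRingType) (x : A) : Prop := forall y, GRing.comm x y.

(* Main.v *)
(* Let D(u) be the scalar with P T_1(u) ... T_m(q^(-2(m-1)) u) = D(u) P, where
   P = P^(m) and P_I^J = u_I v^J: it exists because P T_1 ... T_m absorbs P on
   the right, as R(u, q^-2 u) is proportional to R - q. Hence
   e_m(u) = Tr_R(P) D(u), and Tr_R(P) <> 0 by taking R-traces factor by factor
   in the recursion for P^(k), the value of Tr C being forced by P^(m+1) = 0.

   Moving T(w) through T_1(u_1) ... T_m(u_m) in m+1 factors produces the product
   X = R_1(u_1, w) ... R_m(u_m, w). By fusion P_(2..m+1) X = P_(2..m+1) X P_(1..m),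
   and this equals f(u, w) P_(2..m+1) P_(1..m) with f central and regular. The
   matrix M_i^j = u_(i a) v^(a j), to which N is proportional, appears in
   P_(2..m+1) P_(1..m), and cancelling f gives D(u) M T(w) = T(w) D(u) M.

   If M is scalar (it is nonzero), D commutes with all the generators. Conversely
   the evaluation representation T(u) = F (R^-1 - u^-1 R), with F the flip, maps
   the coefficient D_0 to an invertible matrix, so that a central D forces M to
   commute with T_0 + T_1 = - (q - q^-1) F, hence to be scalar.

   The scalar f is controlled in terms of e = R + q^-1: each factor of X is
   a e + g with a, g central, P_(2..m+1) and P_(1..m) annihilate all but the
   first, respectively the last of the e_j, and only two terms survive. *)

Require Import Defs.
From HB Require Import structures.
From mathcomp Require Import all_boot all_order all_algebra.
From mathcomp Require Import generic_quotient boolp monalg reals complex.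
From mathcomp Require Import ring zify.

Set Implicit Arguments.
Unset Strict Implicit.
Unset Printing Implicit Defensive.

Import GRing.Theory.
Local Open Scope ring_scope.
Local Open Scope complex_scope.

(** * Power series over a noncommutative ring *)

(** The coefficients do not commute, so f cannot be inverted in a field of fractions. It is
    cancelled in iterated formal series, with u^-1 as outer and w^-1 as inner variable, where it is
    enough that the constant term is left regular. It exists because the parameters can be
    specialized so that the product vanishes with P^(m+1); f does not degenerate because every
    factor can be specialized to the invertible R^-1. The Hecke calculus takes place in an abstract
    ring with central scalars, as it is applied to matrices over K, over an algebra, and to series
    of such matrices. Likewise the identity for D and M holds for any T satisfying the RTT
    relations: the Yangian serves one direction, the evaluation matrices the other. *)

Definition series (B : Type) := nat -> B.

Section SeriesRing.

Variable B : pzRingType.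
Implicit Types (f g h : series B).

HB.instance Definition _ := gen_eqMixin (series B).
HB.instance Definition _ := gen_choiceMixin (series B).

Definition szero : series B := fun=> 0.
Definition sadd f g : series B := fun n => f n + g n.
Definition sopp f : series B := fun n => - f n.
Definition sone : series B := fun n => (n == 0)%:R.
Definition smul f g : series B := fun n => \sum_(i < n.+1) f i * g (n - i)%N.

Lemma saddA : associative sadd.
Proof. by move=> f g h; apply/funext => n; apply: addrA. Qed.
Lemma saddC : commutative sadd.
Proof. by move=> f g; apply/funext => n; apply: addrC. Qed.
Lemma sadd0 : left_id szero sadd.
Proof. by move=> f; apply/funext => n; apply: add0r. Qed.
Lemma saddN : left_inverse szero sopp sadd.
Proof. by move=> f; apply/funext => n; apply: addNr. Qed.

HB.instance Definition _ := GRing.isZmodule.Build (series B)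
  saddA saddC sadd0 saddN.

Lemma smul_rev f g n : smul f g n = \sum_(i < n.+1) f (n - i)%N * g i.
Proof.
rewrite /smul (reindex_inj rev_ord_inj) /=; apply: eq_bigr => i _.
by rewrite subSS subKn // -ltnS.
Qed.

Lemma smulA : associative smul.
Proof.
move=> f g h; apply/funext => n; rewrite [RHS]smul_rev.
pose F j k := f j * (g (n - j - k)%N * h k).
transitivity (\sum_(j < n.+1) \sum_(k < n.+1 | (k <= n - j)%N) F j k).
  apply: eq_bigr => j _; rewrite smul_rev big_distrr /=.
  by rewrite (big_ord_narrow_leq (leq_subr _ _)).
rewrite (exchange_big_dep predT) //=; apply: eq_bigr => k _.
transitivity (\sum_(j < n.+1 | (j <= n - k)%N) F j k).
  by apply: eq_bigl => j; rewrite leq_subRL ?leq_subRL -1?ltnS // addnC.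
rewrite (big_ord_narrow_leq (leq_subr _ _)) big_distrl /=.
by apply: eq_bigr => j _; rewrite /F mulrA subnAC.
Qed.

Lemma smul1l : left_id sone smul.
Proof.
move=> f; apply/funext => n.
by rewrite /smul big_ord_recl subn0 mul1r big1 ?addr0 // => i _; rewrite mul0r.
Qed.
Lemma smul1r : right_id sone smul.
Proof.
move=> f; apply/funext => n.
rewrite smul_rev big_ord_recl subn0 mulr1 big1 ?addr0 // => i _.
by rewrite mulr0.
Qed.
Lemma smulDl : left_distributive smul sadd.
Proof.
move=> f g h; apply/funext => n; rewrite /sadd /smul -big_split /=.
by apply: eq_bigr => i _; rewrite mulrDl.
Qed.
Lemma smulDr : right_distributive smul sadd.
Proof.
move=> f g h; apply/funext => n; rewrite /sadd /smul -big_split /=.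
by apply: eq_bigr => i _; rewrite mulrDr.
Qed.

HB.instance Definition _ := GRing.Zmodule_isPzRing.Build (series B)
  smulA smul1l smul1r smulDl smulDr.

Lemma coefsM f g n : (f * g) n = \sum_(i < n.+1) f i * g (n - i)%N.
Proof. by []. Qed.

Lemma coefs_sum I r (P : pred I) (F : I -> series B) n :
  (\sum_(i <- r | P i) F i) n = \sum_(i <- r | P i) F i n.
Proof. by apply: (big_morph (fun f : series B => f n)). Qed.

Lemma coefs0M f g : (f * g) 0%N = f 0%N * g 0%N.
Proof. by rewrite coefsM big_ord1. Qed.

Definition sconst (b : B) : series B := fun n => if n is 0 then b else 0.
Definition svar : series B := fun n => (n == 1)%:R.

Lemma sconstM b f n : (sconst b * f) n = b * f n.
Proof.
by rewrite coefsM big_ord_recl subn0 big1 ?addr0 // => i _; rewrite mul0r.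
Qed.

Lemma smul_sconst f b n : (f * sconst b) n = f n * b.
Proof.
rewrite [LHS]smul_rev big_ord_recl subn0 big1 ?addr0 // => i _.
by rewrite mulr0.
Qed.

Fact sconst_additive : zmod_morphism sconst.
Proof. by move=> a b; apply/funext => -[|n] //; rewrite [RHS]subr0. Qed.
Fact sconst_multiplicative : monoid_morphism sconst.
Proof.
split=> [|a b]; apply/funext => -[|n] //; first by rewrite sconstM.
by rewrite sconstM [RHS]mulr0.
Qed.
HB.instance Definition _ := GRing.isZmodMorphism.Build B (series B) sconst
  sconst_additive.
HB.instance Definition _ := GRing.isMonoidMorphism.Build B (series B) sconst
  sconst_multiplicative.

Lemma svarM f n : (svar * f) n = if n is n'.+1 then f n' else 0.
Proof.
rewrite coefsM; case: n => [|n]; first by rewrite big_ord1 mul0r.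
rewrite 2!big_ord_recl mul0r add0r mul1r /= subSS subn0 big1 ?addr0 // => i _.
by rewrite mul0r.
Qed.

Lemma smulvar f n : (f * svar) n = if n is n'.+1 then f n' else 0.
Proof.
rewrite [LHS]smul_rev; case: n => [|n]; first by rewrite big_ord1 mulr0.
rewrite 2!big_ord_recl mulr0 add0r mulr1 /= subSS subn0 big1 ?addr0 // => i _.
by rewrite mulr0.
Qed.

Definition coefs0 f : B := f 0%N.
Fact coefs0_additive : zmod_morphism coefs0.
Proof. by []. Qed.
Fact coefs0_multiplicative : monoid_morphism coefs0.
Proof. by split=> // f g; apply: coefs0M. Qed.
HB.instance Definition _ := GRing.isZmodMorphism.Build (series B) B coefs0
  coefs0_additive.
HB.instance Definition _ := GRing.isMonoidMorphism.Build (series B) B coefs0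
  coefs0_multiplicative.

Lemma lreg_svar : GRing.lreg svar.
Proof.
move=> f g /(congr1 (fun k : series B => k \o S)) E; apply/funext => n.
by have := congr1 (fun k : series B => k n) E; rewrite /= !svarM.
Qed.

(** If f g = 0, the lowest coefficient of g not yet known to vanish is multiplied by the constant
    term of f alone. *)
Lemma lreg_series f : GRing.lreg (coefs0 f) -> GRing.lreg f.
Proof.
move=> f0; apply: mulrI0_lreg => g fg0; apply/funext => n.
elim/ltn_ind: n => n IHn; apply: f0.
have := congr1 (fun k : series B => k n) fg0.
rewrite coefsM big_ord_recl subn0 big1 ?addr0 => [-> | i _]; first by rewrite mulr0.
by rewrite IHn ?mulr0 // lift0 subnSK ?leq_subr // ltn_subrL; case: (n) i => // -[].
Qed.

End SeriesRing.

(** * Antisymmetrizers and the Hecke relations *)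

Section Central.

Variable H : pzRingType.
Implicit Types x y z : H.

Lemma central1 : central (1 : H).
Proof. by move=> y; apply: commr_sym; apply: commr1. Qed.

Lemma centralB x y : central x -> central y -> central (x - y).
Proof. by move=> cx cy z; apply: commr_sym; apply: commrB; apply: commr_sym. Qed.

Lemma centralD x y : central x -> central y -> central (x + y).
Proof. by move=> cx cy z; apply: commr_sym; apply: commrD; apply: commr_sym. Qed.

Lemma centralN x : central x -> central (- x).
Proof. by move=> cx z; apply: commr_sym; apply: commrN; apply: commr_sym. Qed.

Lemma centralM x y : central x -> central y -> central (x * y).
Proof. by move=> cx cy z; apply: commr_sym; apply: commrM; apply: commr_sym. Qed.

Lemma central_prod I (r : seq I) (F : I -> H) :
  (forall i, central (F i)) -> central (\prod_(i <- r) F i).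
Proof.
by move=> cF; apply: big_ind => //; [apply: central1 | apply: centralM].
Qed.

End Central.

(* Baxterized form of the Hecke relations, in terms of the generators
   e = r + q^-1, for which antisymmetry reads z e = 0. *)
Lemma hecke_yang_baxter (H : pzRingType) (t e1 e2 a a' g g' : H) :
  central t -> central a -> central a' -> central g -> central g' ->
  e1 * e1 = t * e1 -> e2 * e2 = t * e2 ->
  e1 * e2 * e1 - e1 = e2 * e1 * e2 - e2 ->
  a * a' + t * a * g' + g * g' = 0 ->
  (a * e1 + g) * (a' * e2 + g') * e1 = e2 * (a' * e1 + g') * (a * e2 + g).
Proof.
move=> ct ca ca' cg cg' h1 h2 hb hc.
have sq e : e * e = t * e -> e * g' * (a * e) = t * a * g' * e.
  move=> he; rewrite mulrA -(ca (e * g')) -(cg' e) -!mulrA he (mulrA g') (cg' t).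
  by rewrite !mulrA (ca t).
have -> : (a * e1 + g) * (a' * e2 + g') * e1
    = a * a' * (e1 * e2 * e1) + (t * a * g' + g * g') * e1 + g * a' * (e2 * e1).
  rewrite !mulrDl.
  have -> : a * e1 * (a' * e2 + g') * e1
      = a * a' * (e1 * e2 * e1) + t * a * g' * e1.
    rewrite mulrDr mulrDl -(sq e1 h1) !mulrA; congr (_ + _).
      by rewrite -(mulrA a) -(ca' e1) !mulrA.
    by rewrite -(mulrA a e1) (ca (e1 * g')).
  rewrite mulrDr mulrDl !mulrA -!addrA; congr (_ + (_ + _)).
  by rewrite addrC.
have -> : e2 * (a' * e1 + g') * (a * e2 + g)
    = a * a' * (e2 * e1 * e2) + (t * a * g' + g * g') * e2 + g * a' * (e2 * e1).
  rewrite !mulrDr !mulrDl -(sq e2 h2).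
  have -> : e2 * (a' * e1) * (a * e2) = a * a' * (e2 * e1 * e2).
    by rewrite mulrA -(ca (e2 * (a' * e1))) (mulrA e2 a') -(ca' e2) !mulrA.
  have -> : e2 * (a' * e1) * g = g * a' * (e2 * e1).
    by rewrite -(cg (_ * _)) (mulrA e2) -(ca' e2) !mulrA.
  have -> : e2 * g' * g = g * g' * e2.
    by rewrite -(cg (e2 * g')) -(cg' e2) mulrA.
  by rewrite -!addrA; congr (_ + (_ + _)); rewrite addrC.
congr (_ + _); have -> : t * a * g' + g * g' = - (a * a').
  by apply/eqP; rewrite -addr_eq0 addrC addrA hc.
by rewrite !mulNr -!mulrBr hb.
Qed.

(** * q-numbers for generic q *)

Section QNumbers.

Variables (K : fieldType) (q : K).
Hypothesis hq : generic q.

Lemma generic_neq0 : q != 0. Proof. by case: hq. Qed.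

Lemma generic_expr_neq1 n : (0 < n)%N -> q ^+ n != 1.
Proof. by move=> n0; case: hq => _ /(_ n%:Z); apply; case: n n0. Qed.

Lemma generic_hneq0 : q - q^-1 != 0.
Proof.
have q0 := generic_neq0.
rewrite subr_eq0; apply/eqP => E; have := generic_expr_neq1 (isT : 0 < 2)%N.
by rewrite expr2 {1}E mulVf ?eqxx.
Qed.

Lemma qnumE n : (q - q^-1) * qnum q n = q ^+ n - q ^- n.
Proof. by rewrite /qnum mulrC divfK ?generic_hneq0. Qed.

Lemma qnum_neq0 n : (0 < n)%N -> qnum q n != 0.
Proof.
move=> n0; rewrite /qnum mulf_neq0 ?invr_eq0 ?generic_hneq0 //.
have q0 := generic_neq0.
rewrite subr_eq0; apply/eqP => E.
have := @generic_expr_neq1 (n + n) ltac:(by rewrite addn_gt0 n0).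
by rewrite exprD {1}E mulVf ?eqxx ?expf_neq0.
Qed.

Lemma qnum0 : qnum q 0 = 0. Proof. by rewrite /qnum expr0 invr1 subrr mul0r. Qed.

Lemma qnum1 : qnum q 1 = 1.
Proof. by rewrite /qnum expr1 divff ?generic_hneq0. Qed.

Lemma qnumS n : qnum q n.+1 = q ^+ n + q^-1 * qnum q n.
Proof.
have q0 := generic_neq0; have h0 := generic_hneq0.
apply: (mulfI h0); rewrite mulrDr (mulrCA _ q^-1) !qnumE exprS.
by field; rewrite expf_neq0.
Qed.

Lemma qnum_rec n : qnum q n.+2 + qnum q n = (q + q^-1) * qnum q n.+1.
Proof.
have q0 := generic_neq0; have h0 := generic_hneq0.
apply: (mulfI h0); rewrite mulrDr (mulrCA _ (q + q^-1)) !qnumE !exprS.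
by field; rewrite q0 expf_neq0.
Qed.

End QNumbers.

(** * Antisymmetrizers in an abstract ring *)

Section Antisymmetrizer.

Variables (K : fieldType) (H : pzRingType) (kap : {rmorphism K -> H}) (q : K).
Variables (L : nat) (e : nat -> H).

Definition hecke_gens : Prop :=
  [/\ forall i, (i < L)%N -> e i * e i = kap (q + q^-1) * e i,
      forall i, (i.+1 < L)%N ->
        e i * e i.+1 * e i - e i = e i.+1 * e i * e i.+1 - e i.+1
    & forall i j, (i.+1 < j)%N -> (j < L)%N -> GRing.comm (e i) (e j)].

(* The antisymmetrizer in the factors s, ..., s + k - 1; as [0]_q = 0, the
   generator e_(s-1) that occurs for k = 0 has no effect. *)
Fixpoint antisym s k : H :=
  if k is k'.+1 then
    antisym s k' -
      kap (qnum q k' / qnum q k) * (antisym s k' * e (s + k').-1 * antisym s k')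
  else 1.

Hypothesis kapC : forall a, central (kap a).
Hypothesis hq : generic q.
Hypothesis he : hecke_gens.

Lemma antisym1 s : antisym s 1 = 1.
Proof. by rewrite /= qnum0 mul0r rmorph0 mul0r subr0. Qed.

Lemma antisymS s k : antisym s k.+1 = antisym s k -
  kap (qnum q k / qnum q k.+1) * (antisym s k * e (s + k).-1 * antisym s k).
Proof. by []. Qed.

Lemma antisym_comm s k x :
  (forall j, (s <= j)%N -> (j.+1 < s + k)%N -> GRing.comm x (e j)) ->
  GRing.comm x (antisym s k).
Proof.
elim: k => [|[|k] IHk] hx; [exact: commr1|rewrite antisym1; exact: commr1|].
have ck : GRing.comm x (antisym s k.+1).
  by apply: IHk => j sj jk; apply: hx => //; rewrite addnS ltnW.
rewrite antisymS; apply: commrB => //; apply: commrM.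
  by apply: commr_sym; apply: kapC.
by apply: commrM => //; apply: commrM => //; apply: hx; lia.
Qed.

Lemma antisym_absorb z s k :
  (forall j, (s <= j)%N -> (j.+1 < s + k)%N -> z * e j = 0) ->
  z * antisym s k = z.
Proof.
elim: k => [|[|k] IHk] hz; [exact: mulr1|by rewrite antisym1 mulr1|].
have zk : z * antisym s k.+1 = z.
  by apply: IHk => j sj jk; apply: hz => //; rewrite addnS ltnW.
rewrite antisymS mulrBr zk mulrA -(kapC _ z) -mulrA (mulrA z) (mulrA z) zk.
by rewrite hz ?mul0r ?mulr0 ?subr0 //; lia.
Qed.

Lemma absorb_antisym z s k :
  (forall j, (s <= j)%N -> (j.+1 < s + k)%N -> e j * z = 0) ->
  antisym s k * z = z.
Proof.
elim: k => [|[|k] IHk] hz; [exact: mul1r|by rewrite antisym1 mul1r|].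
have zk : antisym s k.+1 * z = z.
  by apply: IHk => j sj jk; apply: hz => //; rewrite addnS ltnW.
rewrite antisymS mulrBl zk -!mulrA zk.
by rewrite (hz _ _ _) ?mulr0 ?subr0 //; lia.
Qed.

Let c k : H := kap (qnum q k / qnum q k.+1).

(** The hypothesis of [hecke_yang_baxter] for the factors 1 - c_(k+1) e and 1 - c_k e'. It is the
    recursion [k+2] + [k] = (q + q^-1) [k+1] divided by [k+2]. *)
Let c_cond k : (0 < k)%N ->
  c k.+1 * c k - kap (q + q^-1) * c k.+1 + 1 = 0.
Proof.
move=> k0; rewrite /c -!rmorphM -rmorphB -[1](rmorph1 kap) -rmorphD.
have n1 := qnum_neq0 hq (ltn0Sn k); have n2 := qnum_neq0 hq (ltn0Sn k.+1).
apply/eqP; rewrite (_ : _ + 1 = 0) ?rmorph0 //.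
apply: (mulfI n2); rewrite mulr0.
transitivity (qnum q k.+2 + qnum q k - (q + q^-1) * qnum q k.+1).
  by field; rewrite n1 n2 generic_neq0.
by rewrite qnum_rec // subrr.
Qed.

(** Only the generator e_j of the last recursion step is new. The step has the form A X A with A =
    A' Y A', where A' commutes with e_j and X. This brings X, Y and e_j together, and Yang-Baxter
    rewrites X Y e_j as a product starting with the previous generator, which A annihilates. Two
    earlier levels are used, hence the strong induction. *)
Lemma antisym_gen s k j : (s + k <= L.+1)%N -> (s <= j)%N -> (j.+1 < s + k)%N ->
  antisym s k * e j = 0 /\ e j * antisym s k = 0.
Proof.
case: he => eQ eB eC.
elim/ltn_ind: k j => -[|[|k]] IH j skL sj jk; try by exfalso; lia.
have [jk' | jk'] := ltnP j.+1 (s + k.+1).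
  have [A1 A2] := IH k.+1 (leqnn _) j ltac:(lia) sj jk'.
  rewrite antisymS mulrBl mulrBr A2 A1 -!mulrA A1 !mulr0 mulrA -(kapC _ (e j)).
  by rewrite -!mulrA (mulrA (e j)) A2 !mul0r !mulr0 subr0.
have {jk jk'} Ej : j = (s + k)%N by lia.
rewrite antisymS addnS succnK -Ej.
case: k IH skL Ej => [|k] IH skL Ej.
  rewrite antisym1 mul1r mulr1 qnum1 // div1r.
  have q2 : kap (qnum q 2)^-1 * kap (q + q^-1) = 1.
    rewrite -rmorphM -[RHS](rmorph1 kap); congr (kap _).
    by have := qnum_rec hq 0; rewrite qnum0 qnum1 // addr0 mulr1 => <-;
       rewrite mulVf ?qnum_neq0.
  rewrite mulrBl mulrBr mul1r mulr1 mulrA -(kapC _ (e j)) -mulrA.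
  by rewrite eQ ?mulrA ?q2 ?mul1r ?subrr //; lia.
set A := antisym s k.+2; set A' := antisym s k.+1; set a := kap _.
have EA : A = A' - c k.+1 * (A' * e (s + k) * A').
  by rewrite /A antisymS addnS succnK.
have Ae : A * e (s + k) = 0 /\ e (s + k) * A = 0.
  by apply: IH => //; lia.
have A'j : GRing.comm (e j) A'.
  apply: antisym_comm => i si ik; apply: commr_sym; apply: eC; lia.
have AA' : A * A' = A.
  by apply: antisym_absorb => i si ik;
     have [] := IH k.+2 (leqnn _) i ltac:(lia) si ltac:(lia).
have A'A : A' * A = A.
  by apply: absorb_antisym => i si ik;
     have [] := IH k.+2 (leqnn _) i ltac:(lia) si ltac:(lia).
have YB i1 i2 : e i1 * e i1 = kap (q + q^-1) * e i1 ->
    e i2 * e i2 = kap (q + q^-1) * e i2 ->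
    e i1 * e i2 * e i1 - e i1 = e i2 * e i1 * e i2 - e i2 ->
    (- a * e i1 + 1) * (- c k.+1 * e i2 + 1) * e i1
      = e i2 * (- c k.+1 * e i1 + 1) * (- a * e i2 + 1).
  move=> h1 h2 h3; apply: (hecke_yang_baxter (t := kap (q + q^-1))) => //;
    do ?[exact: kapC | exact: central1 | apply: centralN].
  by rewrite mulrNN !mulr1 mulrN c_cond.
have eQ1 := eQ j ltac:(lia); have eQ2 := eQ (s + k)%N ltac:(lia).
have eB' : e j * e (s + k) * e j - e j = e (s + k) * e j * e (s + k) - e (s + k).
  by rewrite Ej addnS eB //; lia.
have sandwich b x B : central b -> B * B = B ->
    B - b * (B * x * B) = B * (- b * x + 1) * B.
  move=> cb BB; rewrite mulrDr mulr1 mulrDl BB addrC mulNr mulrN mulNr.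
  by rewrite (mulrA B b) -(cb B) !mulrA.
have idem n : (n <= k.+2)%N -> antisym s n * antisym s n = antisym s n.
  move=> nk; apply: antisym_absorb => i si ik.
  by have [] := IH n nk i ltac:(lia) si ltac:(lia).
rewrite -/A' in EA.
have -> : A - a * (A * e j * A) = A * (- a * e j + 1) * A.
  by apply: sandwich; [apply: kapC | apply: idem].
set X := - a * e j + 1; set Y := - c k.+1 * e (s + k) + 1.
have {}EA : A = A' * Y * A' by rewrite EA; apply: sandwich; [apply: kapC | apply: idem].
have XA' : X * A' = A' * X.
  apply: commr_sym; apply: commrD; last exact: commr1.
  apply: commrM; last exact: commr_sym.
  by apply: commrN; apply: commr_sym; apply: kapC.
split.
- have -> : A * X * A * e j = A * (X * Y * e j) * A'.
    rewrite {2}EA -{2}AA' !mulrA -(mulrA _ A' (e j)) -A'j.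
    by rewrite -(mulrA A A' X) -XA' !mulrA.
  by rewrite YB // !mulrA; have [-> _] := Ae; rewrite !mul0r.
- have -> : e j * (A * X * A) = A' * (e j * Y * X) * A.
    rewrite {1}EA -{2}A'A !mulrA A'j.
    by rewrite -(mulrA _ A' X) -XA' !mulrA.
  rewrite -(YB (s + k)%N j eQ2 eQ1 (esym eB')).
  by rewrite -!mulrA; have [_ ->] := Ae; rewrite !mulr0.
Qed.

Lemma antisym_genr s k j : (s + k <= L.+1)%N -> (s <= j)%N ->
  (j.+1 < s + k)%N -> antisym s k * e j = 0.
Proof. by move=> *; have [] := @antisym_gen s k j. Qed.

Lemma antisym_genl s k j : (s + k <= L.+1)%N -> (s <= j)%N ->
  (j.+1 < s + k)%N -> e j * antisym s k = 0.
Proof. by move=> *; have [] := @antisym_gen s k j. Qed.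

Lemma antisym_idem s k : (s + k <= L.+1)%N ->
  antisym s k * antisym s k = antisym s k.
Proof. by move=> skL; apply: antisym_absorb => j *; apply: antisym_genr. Qed.


(** * Products of Baxterized factors *)

Variables (al ga : nat -> H).
Hypothesis alC : forall i, central (al i).
Hypothesis gaC : forall i, central (ga i).

Definition baxter_prod a b := \prod_(a <= i < b) (al i * e i + ga i).

Lemma baxter_comm a b x :
  (forall i, (a <= i < b)%N -> GRing.comm x (e i)) ->
  GRing.comm x (baxter_prod a b).
Proof.
move=> hx; rewrite /baxter_prod big_nat; apply: commr_prod => i iab.
apply: commrD; last by apply: commr_sym; apply: gaC.
by apply: commrM; [apply: commr_sym; apply: alC | apply: hx].
Qed.

(** The generator e_j commutes with the factors beyond j + 1, crosses the factors j and j + 1 by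
    Yang-Baxter while becoming e_(j+1), and then commutes with the earlier factors until it meets
    [z]. *)
Lemma baxter_fusion m z j : (m <= L)%N -> (j.+1 < m)%N ->
  al j * al j.+1 + kap (q + q^-1) * al j * ga j.+1 + ga j * ga j.+1 = 0 ->
  z * e j.+1 = 0 -> z * baxter_prod 0 m * e j = 0.
Proof.
case: he => eQ eB eC mL jm cond ze.
rewrite /baxter_prod (big_cat_nat (n := j)) /=; [|by []|by lia].
rewrite (big_cat_nat (m := j) (n := j.+2)) /=; [|by lia|by lia].
rewrite big_nat_recl // big_nat1 -!/(baxter_prod _ _).
have c1 : GRing.comm (e j) (baxter_prod j.+2 m).
  by apply: baxter_comm => i ij; apply: eC; lia.
have c2 : GRing.comm (e j.+1) (baxter_prod 0 j).
  by apply: baxter_comm => i ij; apply: commr_sym; apply: eC; lia.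
have YB := hecke_yang_baxter (kapC _) (alC j) (alC j.+1) (gaC j) (gaC j.+1)
  (eQ j ltac:(lia)) (eQ j.+1 ltac:(lia)) (eB j ltac:(lia)) cond.
set F := al j * e j + ga j in YB *; set F' := al j.+1 * e j.+1 + ga j.+1 in YB *.
rewrite -!mulrA -c1 (mulrA F') (mulrA F) (mulrA F F') YB.
by rewrite -!mulrA (mulrA (baxter_prod 0 j)) -c2 -!mulrA (mulrA z) ze mul0r.
Qed.

Lemma baxter_expand m z z' : (0 < m)%N -> (m <= L)%N ->
  (forall j, (0 < j < m)%N -> z * e j = 0) ->
  (forall j, (j.+1 < m)%N -> e j * z' = 0) ->
  z * baxter_prod 0 m * z' = (\prod_(0 <= i < m) ga i) * (z * z')
     + (\prod_(0 <= i < m) al i) * (z * (\prod_(0 <= i < m) e i) * z').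
Proof.
case: he => eQ eB eC m0 mL ze ez'.
pose E k := \prod_(0 <= i < k) e i.
have alP k : central (\prod_(k <= i < m) al i) by apply: central_prod.
(* If the factor of index 0 contributes [ga 0], each later [e i] meets [z] and vanishes, so all
   later factors contribute [ga] too. The bound n < m keeps the range away from index 0. *)
have absorb n : (n < m)%N ->
    z * baxter_prod (m - n) m = (\prod_(m - n <= i < m) ga i) * z.
  elim: n => [|n IHn] nm.
    by rewrite subn0 /baxter_prod !big_geq // mulr1 mul1r.
  have mn : (m - n.+1 < m)%N by lia.
  rewrite /baxter_prod !(big_ltn mn) (subnSK (ltnW nm)) mulrA mulrDr mulrA -(alC _ z).
  rewrite -mulrA ze ?mulr0 ?add0r; last by lia.
  by rewrite -(gaC _ z) -mulrA IHn ?mulrA // ltnW.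
(* If it contributes [al 0 * e 0], taking [ga] at index k + 1 after e_0 ... e_k lets e_k commute to
   the right and vanish on [z']. Hence all later factors contribute their generator. *)
have tail n : (n < m)%N -> z * E (m - n)%N * baxter_prod (m - n) m * z'
    = (\prod_(m - n <= i < m) al i) * (z * E m * z').
  elim: n => [|n IHn] nm.
    by rewrite subn0 /baxter_prod !big_geq // mulr1 mul1r.
  have mn : (m - n.+1 < m)%N by lia.
  rewrite /baxter_prod !(big_ltn mn) (subnSK (ltnW nm)) -/(baxter_prod _ _).
  case Ek: (m - n.+1)%N mn => [|k] mn; first by lia.
  have <- : k.+2 = (m - n)%N by lia.
  rewrite mulrA mulrDr mulrDl mulrDl -[X in _ + X]mulrA.
  have -> : z * E k.+1 * ga k.+1 * (baxter_prod k.+2 m * z') = 0.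
    rewrite -(gaC _ (z * _)) /E big_nat_recr //= -!mulrA (mulrA (e k)).
    have -> : e k * baxter_prod k.+2 m = baxter_prod k.+2 m * e k.
      by apply: baxter_comm => i ik; apply: eC; lia.
    by rewrite -(mulrA _ (e k)) ez' ?mulr0 //; lia.
  rewrite addr0 (mulrA (z * _)) -(alC _ (z * _)) -!mulrA; congr (_ * _).
  have := IHn (ltnW nm); have -> : (m - n)%N = k.+2 by lia.
  have -> : E k.+2 = E k.+1 * e k.+1 by rewrite /E big_nat_recr.
  by rewrite -!mulrA.
have m1 : (m - m.-1 = 1)%N by lia.
have tm := tail m.-1 ltac:(lia); have am := absorb m.-1 ltac:(lia).
rewrite m1 /E big_nat1 (big_ltn m0) in tm; rewrite m1 in am.
rewrite /baxter_prod big_ltn // -/(baxter_prod _ _) mulrA mulrDr mulrDl mulrDl.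
rewrite -(gaC _ z) -!mulrA (mulrA z (baxter_prod 1 m)) am addrC !(big_ltn m0).
rewrite -!mulrA; congr (_ + _).
rewrite (mulrA z (al _)) -(alC _ z) -!mulrA; congr (_ * _).
by move: tm; rewrite -!mulrA.
Qed.

End Antisymmetrizer.

(* The coefficients of (u - v) R(u,v) = u R^-1 - v R in terms of e, for
   u^-1 proportional to x and v^-1 = y. *)
Section SpectralParameters.

Variables (K : fieldType) (H : pzRingType) (kap : {rmorphism K -> H}) (q : K).
Hypothesis kapC : forall a, central (kap a).
Hypothesis q0 : q != 0.
Variables (x y : H).
Hypothesis xC : central x.
Hypothesis yC : central y.

Definition spec_al i : H := y - kap (q ^+ (2 * i)) * x.
Definition spec_ga i : H := kap (q^-1 * q ^+ (2 * i)) * x - kap q * y.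

Lemma spec_alC i : central (spec_al i).
Proof. by apply: centralB => //; apply: centralM. Qed.

Lemma spec_gaC i : central (spec_ga i).
Proof. by apply: centralB; apply: centralM. Qed.

Lemma spec_gaS i : spec_ga i.+1 = - (kap q * spec_al i).
Proof.
rewrite /spec_ga /spec_al mulrBr opprB mulrA -rmorphM; congr (kap _ * _ - _).
by rewrite mulnS exprD expr2 !mulrA mulVf // mul1r.
Qed.

Lemma spec_alS i :
  spec_al i.+1 = kap ((q + q^-1) * q) * spec_al i + kap q * spec_ga i.
Proof.
have -> : kap ((q + q^-1) * q) = kap (q ^+ 2) + 1.
  by rewrite -[1](rmorph1 kap) -rmorphD; congr (kap _); field.
rewrite mulrDl mul1r /spec_al /spec_ga !mulrBr !(mulrA (kap _)) -!rmorphM.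
have -> : q * (q^-1 * q ^+ (2 * i)) = q ^+ (2 * i) by rewrite mulrA mulfV // mul1r.
have -> : q ^+ 2 * q ^+ (2 * i) = q ^+ (2 * i.+1) by rewrite mulnS exprD.
rewrite expr2; set a := kap (q * q) * y; set b := _ * x; set c := _ * x.
rewrite -addrA subrKA (addrC a) addrA.
by rewrite addrAC addrK addrC.
Qed.

(** After [spec_gaS] and [spec_alS], which express the ratio q^2 of consecutive parameters, the
    terms in al^2 and those in ga al cancel. *)
Lemma spec_cond i :
  spec_al i * spec_al i.+1 + kap (q + q^-1) * spec_al i * spec_ga i.+1
    + spec_ga i * spec_ga i.+1 = 0.
Proof.
rewrite spec_gaS spec_alS; set a := spec_al i; set g := spec_ga i.
have aC : central a by apply: spec_alC.
rewrite (aC (_ + _)) mulrDl !mulrN addrAC.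
have -> : kap (q + q^-1) * a * (kap q * a) = kap ((q + q^-1) * q) * a * a.
  by rewrite rmorphM !mulrA -(mulrA _ a) -(kapC q a) !mulrA.
have -> : g * (kap q * a) = kap q * g * a by rewrite mulrA -(kapC q g).
by rewrite addrK subrr.
Qed.

End SpectralParameters.

(** * Baxterized products and the two overlapping antisymmetrizers *)

Section BaxterAntisymmetrizer.

Variables (K : fieldType) (H : pzRingType) (kap : {rmorphism K -> H}) (q : K).
Variables (m : nat) (e : nat -> H).
Hypothesis kapC : forall a, central (kap a).
Hypothesis hq : generic q.
Hypothesis he : hecke_gens kap q m e.
Hypothesis m0 : (0 < m)%N.

Local Notation A := (antisym kap q e).
Local Notation E := (\prod_(0 <= i < m) e i).

Definition baxter_cond (al ga : nat -> H) := forall j, (j.+1 < m)%N ->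
  al j * al j.+1 + kap (q + q^-1) * al j * ga j.+1 + ga j * ga j.+1 = 0.

Section Product.
Variables al ga : nat -> H.
Hypothesis alC : forall i, central (al i).
Hypothesis gaC : forall i, central (ga i).
Hypothesis cond : baxter_cond al ga.

Lemma antisym_baxter_gen j : (j.+1 < m)%N ->
  A 1 m * baxter_prod e al ga 0 m * e j = 0.
Proof.
move=> jm; apply: (baxter_fusion kapC he alC gaC) => //; first exact: cond.
by apply: (antisym_genr kapC hq he).
Qed.

Lemma antisym_baxter_expand :
  A 1 m * baxter_prod e al ga 0 m * A 0 m
    = (\prod_(0 <= i < m) ga i) * (A 1 m * A 0 m)
      + (\prod_(0 <= i < m) al i) * (A 1 m * E * A 0 m).
Proof.
apply: (baxter_expand he) => // j jm.
  by apply: (antisym_genr kapC hq he); lia.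
by apply: (antisym_genl kapC hq he); lia.
Qed.

(** By fusion the left side is annihilated by the generators inside A 0 m, hence absorbs A 0 m on
    the right, and the two-term expansion computes it. *)
Lemma antisym_baxter c : A 1 m * E * A 0 m = kap c * (A 1 m * A 0 m) ->
  A 1 m * baxter_prod e al ga 0 m
    = (\prod_(0 <= i < m) ga i + (\prod_(0 <= i < m) al i) * kap c)
      * (A 1 m * A 0 m).
Proof.
move=> hc; rewrite mulrDl -mulrA -hc -antisym_baxter_expand.
rewrite (antisym_absorb q kapC) // => j _ jm.
exact: antisym_baxter_gen.
Qed.

End Product.

(* For al j e + ga j proportional to R(q^(-2j), q^(-2m)), the product is
   annihilated by all of e_0, ..., e_(m-1), hence vanishes with A 0 m.+1. *)
Lemma antisym_cycle : A 0 m.+1 = 0 ->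
  exists c, A 1 m * E * A 0 m = kap c * (A 1 m * A 0 m).
Proof.
move=> A0; have q0 := generic_neq0 hq.
pose b j := q ^+ (2 * m) - q ^+ (2 * j).
pose g j := q^-1 * q ^+ (2 * j) - q * q ^+ (2 * m).
pose al j := kap (b j); pose ga j := kap (g j).
have alC j : central (al j) by apply: kapC.
have gaC j : central (ga j) by apply: kapC.
have cond : baxter_cond al ga.
  move=> j jm; rewrite -!rmorphM -!rmorphD /=.
  rewrite (_ : _ + g j * _ = 0) ?rmorph0 // /b /g !mulnS !exprD.
  by field.
have Z0 : A 1 m * baxter_prod e al ga 0 m = 0.
  rewrite -[LHS](antisym_absorb q kapC (s := 0) (k := m.+1) (e := e)).
    by rewrite A0 mulr0.
  move=> j _ jm; have [jm'|mj] := ltnP j.+1 m; first exact: antisym_baxter_gen.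
  have -> : j = m.-1 by lia.
  (* The last pair of parameters has ratio q^2, where the factor is a multiple of e - (q + q^-1),
     that is, of R - q. *)
  have last0 : (al m.-1 * e m.-1 + ga m.-1) * e m.-1 = 0.
    case: he => eQ _ _; rewrite mulrDl -mulrA eQ ?mulrA; last by lia.
    rewrite /al /ga -rmorphM -mulrDl -rmorphD /=.
    rewrite (_ : _ + g _ = 0) ?rmorph0 ?mul0r // /b /g.
    have -> : (2 * m = 2 * m.-1 + 2)%N by lia.
    by rewrite exprD; field.
  rewrite /baxter_prod (big_cat_nat (n := m.-1)) ?leq_pred //=.
  have mE : (m.-1 < m)%N by lia.
  rewrite (big_ltn mE) (big_geq (m := m.-1.+1)); last by lia.
  by rewrite mulr1 -!mulrA last0 !mulr0.
(* b_i = q^(2i) (q^(2(m-i)) - 1) with m - i > 0, so genericity applies. With the product equal to 0,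
   the expansion can then be solved for its second term. *)
have nz : \prod_(0 <= i < m) b i != 0.
  rewrite big_nat prodf_seq_neq0; apply/allP => i _; apply/implyP => im.
  rewrite /b (_ : 2 * m = 2 * i + 2 * (m - i))%N; last by lia.
  rewrite exprD -[X in _ - X]mulr1 -mulrBr mulf_neq0 ?expf_neq0 //.
  by rewrite subr_eq0 (generic_expr_neq1 hq) //; lia.
exists (- (\prod_(0 <= i < m) g i) / \prod_(0 <= i < m) b i).
have := antisym_baxter_expand alC gaC; rewrite Z0 mul0r -!rmorph_prod => /esym.
move=> /eqP; rewrite addrC addr_eq0 => /eqP hE.
have inv : kap (\prod_(0 <= i < m) b i)^-1 * kap (\prod_(0 <= i < m) b i) = 1.
  by rewrite -rmorphM mulVf // rmorph1.
rewrite -[LHS]mul1r -{1}inv -mulrA hE.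
by rewrite mulrN mulrA -rmorphM -mulNr -rmorphN mulrC mulNr.
Qed.

Lemma baxter_unit0 (e' x : nat -> H) z n : (forall i, (i < n)%N -> e' i * x i = 1) ->
  z * \prod_(0 <= i < n) e' i = 0 -> z = 0.
Proof.
elim: n => [|n IHn] ex; first by rewrite big_geq // mulr1.
rewrite big_nat_recr //= mulrA => /(congr1 (fun y => y * x n)).
rewrite -mulrA ex // mulr1 mul0r; apply: IHn => i im; apply: ex.
by rewrite ltnS ltnW.
Qed.

(* Take al j e + ga j = e - q = R^-1. *)
Lemma antisym_cycle_neq0 c : A 1 m <> 0 ->
  A 1 m * E * A 0 m = kap c * (A 1 m * A 0 m) ->
  A 1 m * A 0 m <> 0 /\ (- q) ^+ m + c != 0.
Proof.
move=> A1 hc; have q0 := generic_neq0 hq; case: (he) => eQ _ _.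
have := antisym_baxter (al := fun=> 1) (ga := fun=> kap (- q)) _ _ _ hc.
rewrite !big_const_nat subn0 !iter_mulr !mulr1 expr1n mul1r.
rewrite -rmorphXn -rmorphD /= => H1.
have {H1} Hp : A 1 m * baxter_prod e (fun=> 1) (fun=> kap (- q)) 0 m
    = kap ((- q) ^+ m + c) * (A 1 m * A 0 m).
  apply: H1 => [i|i|j jm]; [exact: central1|exact: kapC|].
  rewrite !mulr1 -rmorphM -(rmorph1 kap) -rmorphM -!rmorphD /=.
  by rewrite (_ : _ + _ = 0) ?rmorph0 //; field.
have nz : A 1 m * baxter_prod e (fun=> 1) (fun=> kap (- q)) 0 m <> 0.
  move=> Z; apply: A1; apply: (baxter_unit0 (x := fun i => e i - kap q^-1) _ Z).
  move=> i im; rewrite mul1r mulrDl !mulrBr eQ // -(kapC q^-1 (e i)).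
  rewrite -mulrBl -rmorphB addrK -rmorphM mulNr divff //.
  by rewrite !rmorphN rmorph1 opprK mulNr addrA subrr add0r.
split; first by move=> Z; apply: nz; rewrite Hp Z mulr0.
by apply/eqP => Z; apply: nz; rewrite Hp Z rmorph0 mul0r.
Qed.

End BaxterAntisymmetrizer.

(** * Operators placed in tensor factors *)

Section TensorCoef.

Variables (N : nat).

Lemma coef_tensor_mx (A : Type) n (f : n.-tuple 'I_N -> n.-tuple 'I_N -> A) a b :
  coef (tensor_mx f) a b = f a b.
Proof. by rewrite /coef mxE !enum_rankK. Qed.

Lemma tensor_eqP (A : Type) n (X Y : tensor_op A N n) :
  (forall a b, coef X a b = coef Y a b) -> X = Y.
Proof.
move=> XY; apply/matrixP => i j.
by have := XY (enum_val i) (enum_val j); rewrite /coef !enum_valK.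
Qed.

Lemma coef_map (A B : Type) (f : A -> B) n (X : tensor_op A N n) a b :
  coef (map_mx f X) a b = f (coef X a b).
Proof. by rewrite /coef mxE. Qed.

Lemma coefD (A : nmodType) n (X Y : tensor_op A N n) a b :
  coef (X + Y) a b = coef X a b + coef Y a b.
Proof. by rewrite /coef mxE. Qed.

Lemma coefN (A : zmodType) n (X : tensor_op A N n) a b :
  coef (- X) a b = - coef X a b.
Proof. by rewrite /coef mxE. Qed.

Lemma coefZ (A : pzSemiRingType) n c (X : tensor_op A N n) a b :
  coef (c *: X) a b = c * coef X a b.
Proof. by rewrite /coef mxE. Qed.

Lemma coefM (A : pzSemiRingType) n (X Y : tensor_op A N n) a b :
  coef (X *m Y) a b = \sum_c coef X a c * coef Y c b.
Proof.
rewrite /coef mxE (reindex enum_rank) //=.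
by apply: onW_bij; apply: enum_rank_bij.
Qed.

Lemma coef_scalar (A : pzSemiRingType) n (c : A) (a b : n.-tuple 'I_N) :
  coef (c%:M : tensor_op A N n) a b = c *+ (a == b).
Proof. by rewrite /coef mxE (inj_eq enum_rank_inj). Qed.

Lemma trace_coef (A : nmodType) n (X : tensor_op A N n) :
  \tr X = \sum_a coef X a a.
Proof.
rewrite /mxtrace (reindex enum_rank) //=.
by apply: onW_bij; apply: enum_rank_bij.
Qed.

End TensorCoef.

Section Place.

Variables (N : nat).

Definition agree n p (s : p.-tuple 'I_n) (a b : n.-tuple 'I_N) :=
  [forall l, (l \notin s) ==> (tnth a l == tnth b l)].

Definition sub_index n p (s : p.-tuple 'I_n) (a : n.-tuple 'I_N) :
  p.-tuple 'I_N := map_tuple (tnth a) s.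

(** The default value matters: for l outside s, [index l s] is p, beyond the end of d, and [nth]
    returns the old entry of a. *)
Definition upd n p (s : p.-tuple 'I_n) (a : n.-tuple 'I_N) (d : p.-tuple 'I_N)
  : n.-tuple 'I_N := [tuple nth (tnth a l) d (index l s) | l < n].

Lemma agreeP n p (s : p.-tuple 'I_n) a b :
  reflect (forall l, l \notin s -> tnth a l = tnth b l) (agree s a b).
Proof. by apply: (iffP 'forall_implyP) => H l /H /eqP. Qed.

Lemma agree_refl n p (s : p.-tuple 'I_n) a : agree s a a.
Proof. exact/agreeP. Qed.

Lemma tnth_sub n p (s : p.-tuple 'I_n) a i :
  tnth (sub_index s a) i = tnth a (tnth s i).
Proof. by rewrite tnth_map. Qed.

Lemma tnth_upd_out n p (s : p.-tuple 'I_n) a d l :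
  l \notin s -> tnth (upd s a d) l = tnth a l.
Proof.
by move=> ls; rewrite tnth_mktuple memNindex // size_tuple nth_default ?size_tuple.
Qed.

Lemma tnth_upd_in n p (s : p.-tuple 'I_n) a d i :
  uniq s -> tnth (upd s a d) (tnth s i) = tnth d i.
Proof.
move=> us; rewrite tnth_mktuple (tnth_nth (tnth s i) s) index_uniq ?size_tuple //.
by rewrite -tnth_nth.
Qed.

Lemma sub_upd n p (s : p.-tuple 'I_n) a d : uniq s -> sub_index s (upd s a d) = d.
Proof. by move=> us; apply: eq_from_tnth => i; rewrite tnth_sub tnth_upd_in. Qed.

Lemma upd_sub n p (s : p.-tuple 'I_n) a b : uniq s -> agree s a b ->
  upd s a (sub_index s b) = b.
Proof.
move=> us /agreeP ab; apply: eq_from_tnth => l.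
have [ls|ls] := boolP (l \in s); last by rewrite tnth_upd_out // ab.
have /tnthP[i ->] := ls; by rewrite tnth_upd_in // tnth_sub.
Qed.

Lemma agree_upd n p (s : p.-tuple 'I_n) a d : agree s a (upd s a d).
Proof. by apply/agreeP => l ls; rewrite tnth_upd_out. Qed.

Lemma agree_updl n p (s : p.-tuple 'I_n) a b d :
  agree s (upd s a d) b = agree s a b.
Proof.
by apply/agreeP/agreeP => ab l ls; rewrite -ab // tnth_upd_out.
Qed.

Lemma sum_agree (A : nmodType) n p (s : p.-tuple 'I_n) a
    (F : n.-tuple 'I_N -> A) : uniq s ->
  \sum_(c | agree s a c) F c = \sum_d F (upd s a d).
Proof.
move=> us; rewrite (reindex_onto (upd s a) (sub_index s)) /=.
  by apply: eq_bigl => d; rewrite agree_upd sub_upd ?eqxx.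
by move=> c ac; rewrite upd_sub.
Qed.

Section Coef.
Variables (A : nmodType).

Lemma coef_place n p (s : p.-tuple 'I_n) (X : tensor_op A N p) a b :
  coef (place s X) a b =
    if agree s a b then coef X (sub_index s a) (sub_index s b) else 0.
Proof. exact: coef_tensor_mx. Qed.

Lemma coef_place1 n (k : 'I_n) (X : 'M[A]_N) a b :
  coef (place1 k X) a b =
    if agree [tuple k] a b then X (tnth a k) (tnth b k) else 0.
Proof.
rewrite coef_tensor_mx; congr (if _ then _ else _).
by apply: eq_forallb => l; rewrite inE.
Qed.

Lemma placeD n p (s : p.-tuple 'I_n) (X Y : tensor_op A N p) :
  place s (X + Y) = place s X + place s Y.
Proof.
apply: tensor_eqP => a b; rewrite coefD !coef_place coefD.
by case: ifP; rewrite ?addr0.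
Qed.

Lemma place0 n p (s : p.-tuple 'I_n) : place s (0 : tensor_op A N p) = 0.
Proof.
apply: tensor_eqP => a b; rewrite coef_place /coef !mxE.
by case: ifP.
Qed.

Definition comp_pos n p r (s : p.-tuple 'I_n) (t : r.-tuple 'I_p) :
  r.-tuple 'I_n := map_tuple (tnth s) t.

Lemma place_comp n p r (s : p.-tuple 'I_n) (t : r.-tuple 'I_p)
    (X : tensor_op A N r) : uniq s ->
  place s (place t X) = place (comp_pos s t) X.
Proof.
move=> us; apply: tensor_eqP => a b; rewrite !coef_place.
have E c : sub_index (comp_pos s t) c = sub_index t (sub_index s c).
  by apply: eq_from_tnth => i; rewrite !tnth_sub tnth_map.
rewrite !{}E.
suff -> : agree (comp_pos s t) a b
    = agree s a b && agree t (sub_index s a) (sub_index s b).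
  by case: (agree s a b).
apply/agreeP/andP => [ab | [/agreeP ab /agreeP abt] l ls].
  split; apply/agreeP => l lN.
    by apply: ab; apply: contra lN => /mapP[i _ ->]; apply: mem_tnth.
  rewrite !tnth_sub; apply: ab; apply: contra lN => /mapP[i it].
  by move/(tuple_uniqP _ us) => ->.
have [lin | /ab //] := boolP (l \in s).
have /tnthP[i li] := lin; rewrite li -!tnth_sub; apply: abt.
by apply: contra ls => it; rewrite li; apply: map_f.
Qed.

Lemma place_place1 n p (s : p.-tuple 'I_n) (i : 'I_p) (X : 'M[A]_N) : uniq s ->
  place s (place1 i X) = place1 (tnth s i) X.
Proof.
move=> us; apply: tensor_eqP => a b.
rewrite coef_place !coef_place1 !tnth_sub.
suff -> : agree [tuple tnth s i] a b
    = agree s a b && agree [tuple i] (sub_index s a) (sub_index s b).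
  by case: (agree s a b).
apply/agreeP/andP => [ab | [/agreeP ab /agreeP abt] l ls].
  split; apply/agreeP => l lN.
    by apply: ab; apply: contra lN; rewrite inE => /eqP ->; apply: mem_tnth.
  rewrite !tnth_sub; apply: ab; apply: contra lN; rewrite !inE.
  by move/eqP/(tuple_uniqP _ us) => ->.
have [lin | /ab //] := boolP (l \in s).
have /tnthP[j lj] := lin; rewrite lj -!tnth_sub; apply: abt.
by apply: contra ls; rewrite !inE => /eqP <-; rewrite lj.
Qed.

End Coef.

Lemma place_map (A B : nmodType) (f : {additive A -> B}) n p (s : p.-tuple 'I_n)
    (X : tensor_op A N p) : map_mx f (place s X) = place s (map_mx f X).
Proof.
apply: tensor_eqP => a b; rewrite coef_map !coef_place coef_map.
by case: ifP; rewrite ?raddf0.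
Qed.

Lemma placeN (A : zmodType) n p (s : p.-tuple 'I_n) (X : tensor_op A N p) :
  place s (- X) = - place s X.
Proof. by apply/eqP; rewrite -addr_eq0 -placeD addNr place0. Qed.

Section Ring.
Variables (A : pzSemiRingType).

Lemma placeZ n p (s : p.-tuple 'I_n) c (X : tensor_op A N p) :
  place s (c *: X) = c *: place s X.
Proof.
apply: tensor_eqP => a b; rewrite coefZ !coef_place coefZ.
by case: ifP; rewrite ?mulr0.
Qed.

Lemma coef_placeM n p (s : p.-tuple 'I_n) (X : tensor_op A N p)
    (Y : tensor_op A N n) a b : uniq s ->
  coef (place s X *m Y) a b =
    \sum_d coef X (sub_index s a) d * coef Y (upd s a d) b.
Proof.
move=> us; rewrite coefM.
transitivity (\sum_(c | agree s a c) coef X (sub_index s a) (sub_index s c) * coef Y c b).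
  rewrite [RHS]big_mkcond; apply: eq_bigr => c _; rewrite coef_place.
  by case: ifP; rewrite ?mul0r.
by rewrite sum_agree //; apply: eq_bigr => d _; rewrite sub_upd.
Qed.

Lemma placeM n p (s : p.-tuple 'I_n) (X Y : tensor_op A N p) : uniq s ->
  place s (X *m Y) = place s X *m place s Y.
Proof.
move=> us; apply: tensor_eqP => a b; rewrite coef_placeM // coef_place coefM.
case: ifP => ab.
  by apply: eq_bigr => d _; rewrite coef_place agree_updl ab sub_upd.
by rewrite big1 // => d _; rewrite coef_place agree_updl ab mulr0.
Qed.

Lemma place_scalar n p (s : p.-tuple 'I_n) (c : A) :
  place s (c%:M : tensor_op A N p) = c%:M.
Proof.
apply: tensor_eqP => a b; rewrite coef_place !coef_scalar.
case: ifP => [/agreeP ab | /negP nab].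
  congr (_ *+ nat_of_bool _); apply/eqP/eqP => [sab | -> //].
  apply: eq_from_tnth => l; have [/tnthP[i ->]|/ab //] := boolP (l \in s).
  by rewrite -!tnth_sub sab.
by case: eqP => // ab; case: nab; rewrite ab agree_refl.
Qed.

Lemma coef_place_disjoint n p r (s : p.-tuple 'I_n) (t : r.-tuple 'I_n)
    (X : tensor_op A N p) (Y : tensor_op A N r) a b :
  uniq s -> {in s, forall i, i \notin t} ->
  coef (place s X *m place t Y) a b =
    if agree (cat_tuple s t) a b
    then coef X (sub_index s a) (sub_index s b)
      * coef Y (sub_index t a) (sub_index t b) else 0.
Proof.
move=> us st; rewrite coef_placeM //.
have subt d : sub_index t (upd s a d) = sub_index t a.
  apply: eq_from_tnth => i; rewrite !tnth_sub tnth_upd_out //.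
  by apply/negP => /st; rewrite mem_tnth.
rewrite (bigD1 (sub_index s b)) //= big1 ?addr0 => [|d /eqP db]; last first.
  rewrite coef_place; case: ifP; rewrite ?mulr0 // => /agreeP ab.
  case: db; apply: eq_from_tnth => i; rewrite tnth_sub -ab ?st ?mem_tnth //.
  by rewrite tnth_upd_in.
rewrite coef_place subt.
suff -> : agree t (upd s a (sub_index s b)) b = agree (cat_tuple s t) a b.
  by case: ifP; rewrite ?mulr0.
apply/agreeP/agreeP => ab l lN.
  move: lN; rewrite mem_cat negb_or => /andP[ls lt].
  by rewrite -ab // tnth_upd_out.
have [/tnthP[i ->]|ls] := boolP (l \in s); first by rewrite tnth_upd_in ?tnth_sub.
by rewrite tnth_upd_out // ab // mem_cat negb_or ls lN.
Qed.

Lemma place_comm n p r (s : p.-tuple 'I_n) (t : r.-tuple 'I_n)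
    (X : tensor_op A N p) (Y : tensor_op A N r) :
  uniq s -> uniq t -> {in s, forall i, i \notin t} ->
  (forall a b c d, GRing.comm (coef X a b) (coef Y c d)) ->
  place s X *m place t Y = place t Y *m place s X.
Proof.
move=> us ut st XY; apply: tensor_eqP => a b; rewrite !coef_place_disjoint //.
  rewrite XY; congr (if _ then _ else _).
  by apply: eq_forallb => l; rewrite !mem_cat orbC.
by move=> i it; apply/negP => /st; rewrite it.
Qed.

End Ring.

End Place.

(** * From R to the generators e = R + q^-1 *)

Section HeckeFromBraid.

Variables (K : fieldType) (H : pzRingType) (kap : {rmorphism K -> H}) (q : K).
Hypothesis kapC : forall a, central (kap a).
Hypothesis q0 : q != 0.

Lemma hecke_sqr r : (kap q - r) * (kap q^-1 + r) = 0 ->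
  (r + kap q^-1) * (r + kap q^-1) = kap (q + q^-1) * (r + kap q^-1).
Proof.
rewrite (addrC (kap q^-1)) mulrBl => /eqP; rewrite subr_eq0 => /eqP h.
by rewrite mulrDl -h rmorphD mulrDl.
Qed.

(** Each side is a braid word in r1 and r2 plus terms symmetric in them. The subtracted generator
    achieves this symmetry: it lowers the coefficient q^-1 (q + q^-1) of e to q^-2, the coefficient
    of the other r. *)
Lemma hecke_braid r1 r2 : r1 * r2 * r1 = r2 * r1 * r2 ->
  let e1 := r1 + kap q^-1 in let e2 := r2 + kap q^-1 in
  e1 * e1 = kap (q + q^-1) * e1 -> e2 * e2 = kap (q + q^-1) * e2 ->
  e1 * e2 * e1 - e1 = e2 * e1 * e2 - e2.
Proof.
move=> br e1 e2 h1 h2.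
have red e r s : e = r + kap q^-1 -> e * e = kap (q + q^-1) * e ->
    e * (s + kap q^-1) * e - e = r * s * r +
      (kap q^-1 * (r * s + s * r) + kap (q^-1 * q^-1) * (r + s + kap q^-1)).
  move=> Ee h; rewrite mulrDr mulrDl -(kapC q^-1 e) -(mulrA (kap _)) h -addrA.
  have -> : kap q^-1 * (kap (q + q^-1) * e) - e = kap (q^-1 * q^-1) * e.
    rewrite mulrA -rmorphM -[X in _ - X]mul1r -[X in _ - X * e](rmorph1 kap).
    by rewrite -mulrBl -rmorphB; congr (kap _ * _); field.
  have -> : e * s * e = r * s * r + (kap q^-1 * (r * s + s * r)
      + kap (q^-1 * q^-1) * s).
    rewrite Ee mulrDl mulrDr !mulrDl -!addrA; congr (_ + _).
    rewrite -(kapC _ (r * s)) -(kapC _ (kap _ * s)) rmorphM mulrDr !mulrA.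
    by rewrite addrCA -!addrA.
  rewrite -!addrA; congr (_ + (_ + _)); rewrite {}Ee -mulrDr; congr (_ * _).
  by rewrite addrCA addrA.
rewrite (red e1 r1) // (red e2 r2) // br (addrC (r1 * r2)).
by rewrite (addrC r1 r2).
Qed.

End HeckeFromBraid.

(** Meaningful for s + k <= n + 1 only, since [inord] sends positions out of range to 0. *)
Definition shift_pos n s k : k.-tuple 'I_n.+1 := [tuple inord (s + l) | l < k].

Lemma tnth_shift n s k l : tnth (shift_pos n s k) l = inord (s + l).
Proof. by rewrite tnth_mktuple. Qed.

Lemma shift_uniq n s k : (s + k <= n.+1)%N -> uniq (shift_pos n s k).
Proof.
move=> skn; apply/tuple_uniqP => i j; rewrite !tnth_shift => /(congr1 val).
by rewrite /= !inordK; first (by move/addnI/val_inj); have := ltn_ord i;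
  have := ltn_ord j; lia.
Qed.

Section AdjacentPlace.

Variables (N : nat) (A : nmodType).
Variables (R : tensor_op A N 2).

(** [adjacent] for coefficients outside a field. *)
Definition adj n k (X : tensor_op A N 2) : tensor_op A N n.+1 :=
  place [tuple inord k; inord k.+1] X.

Lemma adj_shift n k : adj n k R = place (shift_pos n k 2) R.
Proof.
congr place; apply: eq_from_tnth => i; rewrite tnth_shift.
by case: i => -[|[|//]] i /=; rewrite (tnth_nth ord0) /= ?addn0 ?addn1.
Qed.

Lemma comp_shift n s n' t l : (t + l <= n'.+1)%N ->
  comp_pos (shift_pos n s n'.+1) (shift_pos n' t l) = shift_pos n (s + t) l.
Proof.
move=> tk; apply: eq_from_tnth => i.
rewrite tnth_map !tnth_shift inordK ?addnA //.
by have := ltn_ord i; lia.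
Qed.

Lemma place_adj n s n' j : (s + n' <= n)%N -> (j < n')%N ->
  place (shift_pos n s n'.+1) (adj n' j R) = adj n (s + j) R.
Proof.
move=> sn jn; rewrite !adj_shift place_comp ?comp_shift ?addn2 //.
by apply: shift_uniq; rewrite addnS.
Qed.

Lemma place_id k (X : tensor_op A N k.+1) : place (shift_pos k 0 k.+1) X = X.
Proof.
apply: tensor_eqP => a b.
have E c : sub_index (shift_pos k 0 k.+1) c = c :> k.+1.-tuple 'I_N.
  by apply: eq_from_tnth => i; rewrite tnth_sub tnth_shift inord_val.
rewrite coef_place !E; case: ifP => // /negP[]; apply/agreeP => l.
by rewrite -(inord_val l) -(tnth_shift _ 0) mem_tnth.
Qed.

End AdjacentPlace.

(** * The projectors P^(k) as abstract antisymmetrizers *)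

Section SkewSymmetrizer.

Variables (K : fieldType) (N : nat) (q : K) (R : tensor_op K N 2).
Hypothesis hq : generic q.
Hypothesis hR : hecke_symmetry q R.

Definition egen n j : tensor_op K N n.+1 := adjacent n j R + (q^-1)%:M.

Local Notation kap := (@scalar_mx K _).

Lemma egen_hecke n : hecke_gens (kap : {rmorphism K -> tensor_op K N n.+1}) q n (egen n).
Proof.
have q0 := generic_neq0 hq; case: hR => hB hQ.
have kC p a : central (a%:M : tensor_op K N p) by move=> y; apply/esym/scalar_mxC.
have adjE p j : adjacent p j R = adj p j R by [].
have sq i : (i < n)%N -> egen n i * egen n i = kap (q + q^-1) * egen n i.
  move=> iltn; apply: hecke_sqr => //.
  have u : uniq (shift_pos n i 2) by apply: shift_uniq; lia.
  have := congr1 (place (shift_pos n i 2)) hQ.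
  by rewrite place0 placeM // !placeD !place_scalar // placeN -adj_shift.
have br i : (i.+1 < n)%N -> adjacent n i R * adjacent n i.+1 R * adjacent n i R
    = adjacent n i.+1 R * adjacent n i R * adjacent n i.+1 R.
  move=> iltn; have u : uniq (shift_pos n i 3) by apply: shift_uniq; lia.
  have := congr1 (place (shift_pos n i 3)) hB; rewrite !placeM //.
  by rewrite !adjE !place_adj ?addn0 ?addn1 //; lia.
split=> // [i iltn|i j ij jn].
  exact: (hecke_braid (kC _) q0 (br i iltn) (sq i (ltnW iltn)) (sq _ iltn)).
apply: commrD; last by apply: commr_sym; apply: kC.
apply: commr_sym; apply: commrD; last by apply: commr_sym; apply: kC.
rewrite !adjE !adj_shift; apply: place_comm => //.
- by apply: shift_uniq; lia.
- by apply: shift_uniq; lia.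
- move=> l /tnthP[x ->]; apply/negP => /tnthP[y].
  rewrite !tnth_shift => /(congr1 val); rewrite /= !inordK;
  by case: x y => [[|[|//]]] ? [[|[|//]]] ? /=; lia.
- by move=> *; apply: mulrC.
Qed.

Lemma widen_shift k (le : (k <= k.+1)%N) :
  [tuple widen_ord le l | l < k] = shift_pos k 0 k.
Proof.
apply: eq_from_tnth => i; rewrite tnth_shift tnth_mktuple; apply: val_inj.
by rewrite /= inordK // add0n ltnS ltnW.
Qed.

Lemma skew_symmetrizerSS k : skew_symmetrizer q R k.+2 =
  (qnum q k.+1 / qnum q k.+2) *:
    (place (shift_pos k.+1 0 k.+1) (skew_symmetrizer q R k.+1)
      *m ((q ^+ k.+1 / qnum q k.+1)%:M - adj k.+1 k R)
      *m place (shift_pos k.+1 0 k.+1) (skew_symmetrizer q R k.+1)).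
Proof. by rewrite -widen_shift. Qed.

(** Since [k+1] = q^k + q^-1 [k], the middle factor q^k / [k] - R equals [k+1] / [k] - e.
    Idempotency of the previous projector then turns the sandwich into the recursion of
    [antisym]. *)
Lemma place_skew_symmetrizer n s k : (s + k <= n.+1)%N ->
  place (shift_pos n s k) (skew_symmetrizer q R k)
    = antisym (kap : {rmorphism K -> tensor_op K N n.+1}) q (egen n) s k.
Proof.
move=> skn.
have he := egen_hecke n; have q0 := generic_neq0 hq.
have kC a : central (a%:M : tensor_op K N n.+1) by move=> y; apply/esym/scalar_mxC.
elim: k skn => [|[|k] IHk] skn; first by rewrite place_scalar //; apply: shift_uniq.
  by rewrite antisym1 place_scalar //; apply: shift_uniq.
have us := shift_uniq skn.
rewrite skew_symmetrizerSS placeZ !placeM // place_comp // comp_shift // addn0.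
rewrite IHk; last by lia.
rewrite placeD placeN place_scalar // place_adj; [|lia|lia].
rewrite [RHS]antisymS addnS succnK.
set A := antisym _ _ _ _ _; set c := _ / _.
have AA : A *m A = A by apply: (antisym_idem kC hq he); lia.
have -> : (q ^+ k.+1 / qnum q k.+1)%:M - adj n (s + k) R
    = c^-1%:M - egen n (s + k) :> tensor_op K N n.+1.
  have -> : c^-1 = q ^+ k.+1 / qnum q k.+1 + q^-1.
    by rewrite /c invf_div (qnumS hq k.+1) mulrDl mulfK ?qnum_neq0.
  by rewrite raddfD opprD addrACA subrr addr0.
have c0 : c != 0 by rewrite mulf_neq0 ?invr_eq0 ?qnum_neq0.
clearbody A.
rewrite mulmxBr mulmxBl scalar_mxC -(mulmxA _ A A) AA mul_scalar_mx scalerBr scalerA.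
by rewrite mulfV // scale1r; congr (_ - _); apply/esym/mul_scalar_mx.
Qed.

Lemma skew_symmetrizerE k :
  skew_symmetrizer q R k.+1
    = antisym (kap : {rmorphism K -> tensor_op K N k.+1}) q (egen k) 0 k.+1.
Proof. by rewrite -place_skew_symmetrizer // place_id. Qed.

End SkewSymmetrizer.

(** * First and last factors, and the R-trace *)

Section FirstLast.

Variables (N m : nat).
Implicit Types (a b c : m.+1.-tuple 'I_N) (I J : m.-tuple 'I_N) (i j : 'I_N).

Local Notation init := (shift_pos m 0 m).
Local Notation tail := (shift_pos m 1 m).

Lemma init_uniq : uniq init. Proof. exact: shift_uniq. Qed.

Lemma notin_init (l : 'I_m.+1) : (l \notin init) = (l == ord_max).
Proof.
apply/idP/eqP => [|->].
  apply: contraNeq => lm; have lt : (l < m)%N.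
    by have := ltn_ord l; rewrite ltnS leq_eqVlt => /orP[/eqP lE|//];
       case/eqP: lm; apply: val_inj.
  by rewrite -(inord_val l) -[l in inord l]/(0 + Ordinal lt)%N -tnth_shift mem_tnth.
apply/negP => /tnthP[x]; rewrite tnth_shift => /(congr1 val) /=.
by rewrite inordK; have := ltn_ord x; lia.
Qed.

Lemma notin_tail (l : 'I_m.+1) : (l \notin tail) = (l == ord0).
Proof.
apply/idP/eqP => [|->].
  apply: contraNeq => lm; have lt : (l.-1 < m)%N.
    have := ltn_ord l; have : l != 0 :> nat by apply: contra lm => /eqP l0; apply/eqP/val_inj.
    by lia.
  have lE : l = (1 + Ordinal lt)%N :> nat.
    by rewrite /= add1n prednK // lt0n; apply: contra lm => /eqP l0; apply/eqP/val_inj.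
  by rewrite -(inord_val l) lE -tnth_shift mem_tnth.
apply/negP => /tnthP[x]; rewrite tnth_shift => /(congr1 val) /=.
by rewrite inordK; have := ltn_ord x; lia.
Qed.

Lemma agree_init a b : agree init a b = (tnth a ord_max == tnth b ord_max).
Proof.
apply/agreeP/eqP => [-> //|ab l]; first by rewrite notin_init.
by rewrite notin_init => /eqP ->.
Qed.

Lemma agree_tail a b : agree tail a b = (tnth a ord0 == tnth b ord0).
Proof.
apply/agreeP/eqP => [-> //|ab l]; first by rewrite notin_tail.
by rewrite notin_tail => /eqP ->.
Qed.

Lemma tnth_rcons_max I j : tnth (rcons_tuple I j) ord_max = j.
Proof. by rewrite (tnth_nth j) /= nth_rcons size_tuple ltnn eqxx. Qed.

Lemma init_rcons I j : sub_index init (rcons_tuple I j) = I.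
Proof.
apply: eq_from_tnth => i; rewrite tnth_sub tnth_shift !(tnth_nth j) /=.
by rewrite inordK ?ltnS ?(ltnW (ltn_ord i)) // nth_rcons size_tuple ltn_ord.
Qed.

Lemma rcons_init a : rcons_tuple (sub_index init a) (tnth a ord_max) = a.
Proof.
apply: eq_from_tnth => l; have [/eqP ->|] := boolP (l == ord_max).
  exact: tnth_rcons_max.
rewrite -notin_init negbK => /tnthP[i ->].
by rewrite -[LHS]tnth_sub init_rcons tnth_sub.
Qed.

Lemma tnth_cons0 i I : tnth (cons_tuple i I) ord0 = i.
Proof. by []. Qed.

Lemma tail_cons i I : sub_index tail (cons_tuple i I) = I.
Proof.
apply: eq_from_tnth => k; rewrite tnth_sub tnth_shift !(tnth_nth i) /=.
by rewrite inordK ?ltnS ?ltn_ord.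
Qed.

Lemma cons_tail a : cons_tuple (tnth a ord0) (sub_index tail a) = a.
Proof.
apply: eq_from_tnth => l; have [/eqP ->//|] := boolP (l == ord0).
rewrite -notin_tail negbK => /tnthP[i ->].
by rewrite -[LHS]tnth_sub tail_cons tnth_sub.
Qed.

Lemma sum_rcons (A : nmodType) (F : m.+1.-tuple 'I_N -> A) :
  \sum_a F a = \sum_I \sum_j F (rcons_tuple I j).
Proof.
rewrite pair_big /= (reindex (fun p => rcons_tuple p.1 p.2)) //=.
exists (fun a => (sub_index init a, tnth a ord_max)) => [[I j] _|a _] /=.
  by rewrite init_rcons tnth_rcons_max.
exact: rcons_init.
Qed.

Lemma sum_cons (A : nmodType) (F : m.+1.-tuple 'I_N -> A) :
  \sum_a F a = \sum_i \sum_I F (cons_tuple i I).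
Proof.
rewrite pair_big /= (reindex (fun p => cons_tuple p.1 p.2)) //=.
exists (fun a => (tnth a ord0, sub_index tail a)) => [[i I] _|a _] /=.
  by rewrite tail_cons.
exact: cons_tail.
Qed.

Lemma coef_place_init (A : nmodType) (X : tensor_op A N m) I i J j :
  coef (place init X) (rcons_tuple I i) (rcons_tuple J j)
    = if i == j then coef X I J else 0.
Proof. by rewrite coef_place agree_init !tnth_rcons_max !init_rcons. Qed.

Lemma coef_place_tail (A : nmodType) (X : tensor_op A N m) I i J j :
  coef (place tail X) (cons_tuple i I) (cons_tuple j J)
    = if i == j then coef X I J else 0.
Proof. by rewrite coef_place agree_tail !tnth_cons0 !tail_cons. Qed.

Lemma coef_place1_max (A : nmodType) (X : 'M[A]_N) I i J j :
  coef (place1 ord_max X) (rcons_tuple I i) (rcons_tuple J j)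
    = if I == J then X i j else 0.
Proof.
rewrite coef_place1 !tnth_rcons_max; congr (if _ then _ else _).
apply/agreeP/eqP => [ab|-> l].
  apply: eq_from_tnth => k; rewrite -[I](init_rcons _ i) -[J](init_rcons _ j).
  rewrite !tnth_sub ab // inE -notin_init negbK mem_tnth //.
rewrite inE -notin_init negbK => /tnthP[k ->].
by rewrite -!tnth_sub !init_rcons.
Qed.

Lemma coef_place1_0 (A : nmodType) (X : 'M[A]_N) I i J j :
  coef (place1 ord0 X) (cons_tuple i I) (cons_tuple j J)
    = if I == J then X i j else 0.
Proof.
rewrite coef_place1 !tnth_cons0; congr (if _ then _ else _).
apply/agreeP/eqP => [ab|-> l].
  apply: eq_from_tnth => k; rewrite -[I](tail_cons i) -[J](tail_cons j).
  rewrite !tnth_sub ab // inE -notin_tail negbK mem_tnth //.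
rewrite inE -notin_tail negbK => /tnthP[k ->].
by rewrite -!tnth_sub !tail_cons.
Qed.

End FirstLast.

(** * The matrix M *)

Section Contraction.

Variables (K : fieldType) (N m : nat) (u v : m.-tuple 'I_N -> K).

Definition contraction : 'M[K]_N := \matrix_(i, j)
  \sum_(a : m.-tuple 'I_N) \sum_(b : m.-tuple 'I_N | rcons a j == i :: b) u a * v b.

Lemma NmxE q : Nmx q u v = ((-1) ^+ m.-1 * q * qnum q m) *: contraction.
Proof. by apply/matrixP => i j; rewrite !mxE. Qed.

(** The intermediate multi-index is (i, d) as seen by the left projector and (a, j) as seen by the
    right one. Summing v_d u_a over the compatible pairs gives M, while u_I and v_J stay outside. *)
Lemma coef_contraction (P : tensor_op K N m) (i : 'I_N) I J j :
  (forall a b, coef P a b = u a * v b) ->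
  coef (place (shift_pos m 1 m) P *m place (shift_pos m 0 m) P)
    (cons_tuple i I) (rcons_tuple J j) = u I * v J * contraction i j.
Proof.
move=> hP; rewrite coefM sum_cons (bigD1 i) //=.
rewrite [X in _ + X]big1 ?addr0 => [|k /negPf ki]; last first.
  by apply: big1 => d _; rewrite coef_place_tail eq_sym ki mul0r.
rewrite mxE (exchange_big_dep predT) //= big_distrr; apply: eq_bigr => d _ /=.
rewrite coef_place_tail eqxx hP; set c := cons_tuple i d.
rewrite -{1}(rcons_init c) coef_place_init.
have E (a : m.-tuple 'I_N) : (rcons a j == i :: d)
    = (a == sub_index (shift_pos m 0 m) c) && (tnth c ord_max == j).
  apply/eqP/andP => [/= ajE | [/eqP -> /eqP <-]].
    have <- : rcons_tuple a j = c by apply: val_inj.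
    by rewrite init_rcons tnth_rcons_max.
  by have /(congr1 val) := rcons_init c.
rewrite (eq_bigl _ _ E); case: ifP => cj.
  rewrite (eq_bigl (pred1 (sub_index (shift_pos m 0 m) c))); last first.
    by move=> a; rewrite andbT.
  by rewrite big_pred1_eq hP; ring.
by rewrite big_pred0 ?mulr0 // => a; rewrite andbF.
Qed.

End Contraction.

(** * R-traces, one factor at a time *)

Section RTrace.

Variables (K : fieldType) (N : nat) (C : 'M[K]_N).

Definition ctensor n : tensor_op K N n := \prod_(k < n) place1 k C.

Definition ptrace n (X : tensor_op K N n.+1) : tensor_op K N n :=
  tensor_mx (fun I J => \sum_i \sum_j
    coef X (rcons_tuple I i) (rcons_tuple J j) * C j i).

Lemma ctensorS n : ctensor n.+1
  = place (shift_pos n 0 n) (ctensor n) *m place1 ord_max C.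
Proof.
rewrite /ctensor big_ord_recr /=; congr (_ *m _).
have u := @init_uniq n.
have pm (X Y : tensor_op K N n) : place (shift_pos n 0 n) (X * Y)
    = place (shift_pos n 0 n) X * place (shift_pos n 0 n) Y by apply: placeM.
rewrite (big_morph _ pm (@place_scalar N K _ _ (shift_pos n 0 n) 1)); apply: eq_bigr => k _.
rewrite place_place1 // tnth_shift; congr place1; apply: val_inj.
by rewrite /= inordK // add0n ltnS ltnW.
Qed.

Lemma ptrace_trace n (X : tensor_op K N n.+1) (Y : tensor_op K N n) :
  \tr (X *m (place (shift_pos n 0 n) Y *m place1 ord_max C))
    = \tr (ptrace X *m Y).
Proof.
have E J j I i : coef (place (shift_pos n 0 n) Y *m place1 ord_max C)
    (rcons_tuple J j) (rcons_tuple I i) = coef Y J I * C j i.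
  rewrite coefM sum_rcons (bigD1 I) //= (bigD1 j) //= coef_place_init eqxx.
  rewrite coef_place1_max eqxx big1 ?addr0 ?big1 ?addr0 // => [J' /negPf JI|j' /negPf ji].
    by apply: big1 => j' _; rewrite coef_place1_max JI mulr0.
  by rewrite coef_place_init eq_sym ji mul0r.
rewrite !trace_coef sum_rcons; apply: eq_bigr => I _; rewrite coefM.
rewrite (eq_bigr (fun i => \sum_J \sum_j coef X (rcons_tuple I i) (rcons_tuple J j)
   * (coef Y J I * C j i))); last first.
  by move=> i _; rewrite coefM sum_rcons; apply: eq_bigr => J _; apply: eq_bigr => j _; rewrite E.
rewrite exchange_big; apply: eq_bigr => J _ /=.
rewrite coef_tensor_mx big_distrl; apply: eq_bigr => i _ /=.
by rewrite big_distrl; apply: eq_bigr => j _ /=; ring.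
Qed.

Lemma ptrace_sandwich n (X Y : tensor_op K N n) (Z : tensor_op K N n.+1) :
  ptrace (place (shift_pos n 0 n) X *m Z *m place (shift_pos n 0 n) Y)
    = X *m ptrace Z *m Y.
Proof.
apply: tensor_eqP => I J; rewrite coef_tensor_mx coefM.
have E I' i J' j : coef (place (shift_pos n 0 n) X *m Z *m place (shift_pos n 0 n) Y)
    (rcons_tuple I' i) (rcons_tuple J' j)
    = \sum_A \sum_B coef X I' B * coef Z (rcons_tuple B i) (rcons_tuple A j) * coef Y A J'.
  rewrite coefM sum_rcons; apply: eq_bigr => A _.
  rewrite (bigD1 j) //= coef_place_init eqxx [X in _ + X]big1 ?addr0 => [|k /negPf kj]; last first.
    by rewrite coef_place_init kj mulr0.
  rewrite coefM sum_rcons big_distrl /=; apply: eq_bigr => B _.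
  rewrite (bigD1 i) //= coef_place_init eqxx [X in _ + X]big1 ?addr0 // => k /negPf ki.
  by rewrite coef_place_init eq_sym ki mul0r.
under eq_bigr => i _ do under eq_bigr => j _ do rewrite E big_distrl /=.
under eq_bigr => i _ do rewrite exchange_big /=.
rewrite exchange_big /=; apply: eq_bigr => A _; rewrite coefM big_distrl /=.
under eq_bigr => i _ do under eq_bigr => j _ do rewrite big_distrl /=.
under eq_bigr => i _ do rewrite exchange_big /=.
rewrite exchange_big /=; apply: eq_bigr => B _.
rewrite coef_tensor_mx big_distrr big_distrl /=; apply: eq_bigr => i _.
rewrite big_distrr big_distrl /=; apply: eq_bigr => j _.
by ring.
Qed.

Lemma ptraceD n (X Y : tensor_op K N n.+1) : ptrace (X + Y) = ptrace X + ptrace Y.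
Proof.
apply: tensor_eqP => I J; rewrite coefD !coef_tensor_mx -big_split /=.
apply: eq_bigr => i _; rewrite -big_split /=; apply: eq_bigr => j _.
by rewrite coefD mulrDl.
Qed.

Lemma ptraceZ n c (X : tensor_op K N n.+1) : ptrace (c *: X) = c *: ptrace X.
Proof.
apply: tensor_eqP => I J; rewrite coefZ !coef_tensor_mx big_distrr /=.
apply: eq_bigr => i _; rewrite big_distrr /=; apply: eq_bigr => j _.
by rewrite coefZ mulrA.
Qed.

Lemma ptrace1 n : ptrace (1%:M : tensor_op K N n.+1) = (\tr C)%:M.
Proof.
apply: tensor_eqP => I J; rewrite coef_tensor_mx coef_scalar -(@place_scalar N K _ _ (shift_pos n 0 n)).
have [-> | /negPf IJ] := eqVneq I J.
  apply: eq_bigr => i _; rewrite (bigD1 i) //= coef_place_init eqxx coef_scalar eqxx.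
  by rewrite mul1r big1 ?addr0 // => j /negPf ji; rewrite coef_place_init eq_sym ji mul0r.
apply: big1 => i _; apply: big1 => j _.
by rewrite coef_place_init coef_scalar IJ; case: ifP; rewrite mul0r.
Qed.

End RTrace.

Section RTraceHecke.

Variables (K : fieldType) (N : nat) (q : K) (R Psi : tensor_op K N 2).
Hypothesis hq : generic q.
Hypothesis hR : hecke_symmetry q R.
Hypothesis hPsi : skew_inverse R Psi.

Local Notation C := (Cmx Psi).

Lemma coef_adj_last n (I J : n.+1.-tuple 'I_N) i j :
  coef (adj n.+1 n R) (rcons_tuple I i) (rcons_tuple J j) =
    if sub_index (shift_pos n 0 n) I == sub_index (shift_pos n 0 n) J
    then coef R [tuple tnth I ord_max; i] [tuple tnth J ord_max; j] else 0.
Proof.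
have subE (L : n.+1.-tuple 'I_N) l :
    sub_index [tuple inord n; inord n.+1] (rcons_tuple L l) = [tuple tnth L ord_max; l].
  apply: eq_from_tnth => k; rewrite tnth_sub.
  case: k => -[|[|//]] k; rewrite !(tnth_nth l) /= inordK // nth_rcons size_tuple.
    by rewrite ltnSn.
  by rewrite ltnn eqxx.
have tl (L : n.+1.-tuple 'I_N) l (k : 'I_n) :
    tnth (rcons_tuple L l) (inord k) = tnth (sub_index (shift_pos n 0 n) L) k.
  have kn : (k < n.+1)%N by rewrite ltnS ltnW.
  rewrite tnth_sub tnth_shift !(tnth_nth l) /= !inordK ?ltnS ?(ltnW kn) //.
  by rewrite nth_rcons size_tuple kn.
rewrite coef_place !subE; congr (if _ then _ else _).
apply/agreeP/eqP => [ab|IJ l lN].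
  apply: eq_from_tnth => k; rewrite -(tl _ i) -(tl _ j) ab //.
  rewrite !inE -!(inj_eq val_inj) /= !inordK //; have := ltn_ord k; lia.
have ln : (l < n)%N.
  move: lN; rewrite !inE -!(inj_eq val_inj) /= !inordK //.
  by have := ltn_ord l; lia.
by rewrite -(inord_val l) (tl I i (Ordinal ln)) (tl J j (Ordinal ln)) IJ.
Qed.

(** Taking r = p in [skew_inverse] and summing over p replaces Psi by C. *)
Lemma ptrace_R n : ptrace C (adj n.+1 n R) = 1%:M.
Proof.
apply: tensor_eqP => I J; rewrite coef_tensor_mx coef_scalar.
under eq_bigr => i _ do under eq_bigr => j _ do rewrite coef_adj_last.
have IJE : (I == J) = (sub_index (shift_pos n 0 n) I == sub_index (shift_pos n 0 n) J)
    && (tnth I ord_max == tnth J ord_max).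
  apply/eqP/andP => [-> | [/eqP h1 /eqP h2]]; first by rewrite !eqxx.
  by rewrite -(rcons_init I) h1 h2 rcons_init.
rewrite IJE; case: (sub_index _ I == _); last first.
  by apply: big1 => i _; apply: big1 => j _; rewrite mul0r.
set x := tnth I _; set y := tnth J _.
transitivity (\sum_p \sum_i \sum_j
    coef R [tuple x; i] [tuple y; j] * coef Psi [tuple j; p] [tuple i; p]).
  rewrite [RHS]exchange_big; apply: eq_bigr => i _; rewrite [RHS]exchange_big /=.
  by apply: eq_bigr => j _; rewrite mxE big_distrr.
under eq_bigr => p _ do rewrite hPsi.
rewrite (bigD1 x) //= eqxx eq_sym big1 ?addr0 // => p /negPf px.
by rewrite eq_sym px.
Qed.

(** The outer projectors do not involve the last factor and leave the trace. What remains inside is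
    scalar, because the R-traces of R and of 1 are 1 and Tr C. *)
Lemma ptrace_antisym n :
  ptrace C (skew_symmetrizer q R n.+2)
    = ((q ^+ n.+1 * \tr C - qnum q n.+1) / qnum q n.+2)
        *: skew_symmetrizer q R n.+1.
Proof.
have q0 := generic_neq0 hq.
have kC a : central (a%:M : tensor_op K N n.+1) by move=> y; apply/esym/scalar_mxC.
rewrite skew_symmetrizerSS ptraceZ ptrace_sandwich ptraceD -scaleN1r ptraceZ.
rewrite ptrace_R -(scalemx1 _ (_ / _)) ptraceZ ptrace1 !scale_scalar_mx mulN1r.
rewrite -raddfD /= scalar_mxC -mulmxA.
have -> : skew_symmetrizer q R n.+1 *m skew_symmetrizer q R n.+1
    = skew_symmetrizer q R n.+1.
  rewrite (skew_symmetrizerE hq hR).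
  by apply: (antisym_idem kC hq (egen_hecke hq hR n)).
rewrite mul_scalar_mx scalerA; congr (_ *: _).
by field; rewrite ?qnum_neq0.
Qed.

Definition rtrace n (X : tensor_op K N n) := \tr (X *m ctensor C n).

Lemma rtrace_antisym n :
  rtrace (skew_symmetrizer q R n.+2)
    = ((q ^+ n.+1 * \tr C - qnum q n.+1) / qnum q n.+2)
        * rtrace (skew_symmetrizer q R n.+1).
Proof.
rewrite /rtrace ctensorS ptrace_trace ptrace_antisym -scalemxAl.
by rewrite mxtraceZ.
Qed.

Lemma rtrace_antisym1 : rtrace (skew_symmetrizer q R 1) = \tr C.
Proof.
rewrite /rtrace ctensorS ptrace_trace ptrace1 mul_scalar_mx mxtraceZ.
rewrite /ctensor big_ord0 trace_coef (big_pred1 [tuple]) => [|a]; last first.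
  by rewrite [a]tuple0 /= eqxx.
by rewrite coef_scalar eqxx mulr1.
Qed.

Lemma rtrace_antisym_neq0 m : (0 < m)%N -> even_birank q R m ->
  rtrace (skew_symmetrizer q R m) != 0.
Proof.
case: m => // m _ [Pm Pm1]; have q0 := generic_neq0 hq.
have trC : q ^+ m.+1 * \tr C = qnum q m.+1.
  have := ptrace_antisym m; rewrite Pm1 //.
  rewrite (_ : ptrace C 0 = 0); last first.
    by rewrite -(scale0r 0) ptraceZ scale0r.
  move=> /esym/eqP; rewrite scaler_eq0 mulf_eq0 invr_eq0 (negPf (qnum_neq0 _ _)) // orbF.
  by case/orP=> /eqP // /subr0_eq.
have trC0 : \tr C != 0.
  by have := qnum_neq0 hq (ltn0Sn m); rewrite -trC mulf_eq0 negb_or => /andP[].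
suff : forall k, (k <= m)%N -> rtrace (skew_symmetrizer q R k.+1) != 0 by apply.
elim=> [|k IHk] km; first by rewrite rtrace_antisym1.
rewrite rtrace_antisym mulf_neq0 ?IHk ?(ltnW km) // mulf_neq0 ?invr_eq0 ?qnum_neq0 //.
rewrite subr_eq0; apply/eqP => E.
(* So q^n Tr C = [n] determines q^(2n), and by genericity n. It holds for the index m + 1 by [trC],
   hence for no smaller one. *)
have htr n : q ^+ n * \tr C = qnum q n -> q ^+ (2 * n) * (1 - (q - q^-1) * \tr C) = 1.
  move=> /(congr1 (fun x => (q - q^-1) * x)); rewrite qnumE // => En.
  have -> : q ^+ (2 * n) * (1 - (q - q^-1) * \tr C)
      = q ^+ n * (q ^+ n - (q - q^-1) * (q ^+ n * \tr C)).
    by rewrite mul2n -addnn exprD; ring.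
  by rewrite En opprB addrC subrK mulfV ?expf_neq0.
have := generic_expr_neq1 hq (_ : 0 < 2 * (m - k.+1).+1)%N.
case/(_ isT)/eqP; have <- := htr _ E; rewrite -[LHS]mulr1 -(htr _ E) mulrA -exprD.
rewrite (_ : 2 * _ + 2 * k.+1 = 2 * m.+1)%N ?htr //; lia.
Qed.

End RTraceHecke.

(** * Products of series and the RTT relations *)

Section SeriesProduct.

Variable B : pzRingType.
Implicit Types (f g : series B).

Lemma svarX d k : ((svar B) ^+ d) k = (k == d)%:R.
Proof.
elim: d k => [|d IHd] k; first by rewrite expr0.
by rewrite exprS svarM; case: k => [|k]; rewrite ?IHd.
Qed.

Lemma central_svar : central (svar B).
Proof. by move=> f; apply/funext => n; rewrite svarM smulvar. Qed.

Lemma central_sconst (b : B) : central b -> central (sconst b).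
Proof. by move=> cb f; apply/funext => n; rewrite sconstM smul_sconst cb. Qed.

Lemma eq_coefs_prod k n (f g : nat -> series B) :
  (forall i d, (i < n)%N -> (d <= k)%N -> f i d = g i d) ->
  (\prod_(0 <= i < n) f i) k = (\prod_(0 <= i < n) g i) k.
Proof.
elim: n k => [|n IHn] k fg; first by rewrite !big_geq.
rewrite !big_nat_recr //= !coefsM; apply: eq_bigr => i _.
rewrite fg ?leq_subr //; congr (_ * _); apply: IHn => j d jn di.
by apply: fg; [exact: leqW | apply: leq_trans di _; rewrite -ltnS].
Qed.

Lemma coefs_prod n (f : nat -> series B) k :
  (\prod_(0 <= i < n) f i) k =
    \sum_(d : {ffun 'I_n -> 'I_k.+1} | (\sum_(i < n) d i)%N == k)
      \prod_(i < n) f i (d i).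
Proof.
(* Truncation beyond degree k does not change the coefficient of degree k, and makes finite
   distributivity available. *)
pose g i := \sum_(d < k.+1) sconst (f i d) * svar B ^+ d.
rewrite (@eq_coefs_prod k n f g) => [|i d _ dk]; last first.
  rewrite /g coefs_sum; have dk' : (d < k.+1)%N by [].
  rewrite (bigD1 (Ordinal dk')) //= sconstM svarX eqxx mulr1 big1 ?addr0 // => j jd.
  rewrite sconstM svarX [d == j]eq_sym.
  by case: eqP => [jE|]; rewrite ?mulr0 //; case/eqP: jd; apply: val_inj.
rewrite big_mkord /g bigA_distr_bigA /= coefs_sum [RHS]big_mkcond /=.
apply: eq_bigr => d _.
have -> : \prod_(i < n) (sconst (f i (d i)) * svar B ^+ d i)
    = sconst (\prod_(i < n) f i (d i)) * svar B ^+ (\sum_(i < n) d i)%N.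
  elim/big_rec3: _ => [|i x y z _ ->]; first by rewrite rmorph1 expr0 mulr1.
  rewrite rmorphM exprD -!mulrA; congr (_ * _); rewrite !mulrA; congr (_ * _).
  by apply: commr_sym; apply: commrX; apply: commr_sym; apply: central_svar.
rewrite sconstM svarX eq_sym; case: ifP => _; by rewrite ?mulr1 ?mulr0.
Qed.

End SeriesProduct.

(** * Exchange and fusion in a ring *)

Section Exchange.

Variable H : pzRingType.

(** Each R(u_k, w), here [a k], moves T(w) one tensor factor to the left and T(u_k) one to the
    right. [b] and [b'] are the T(u_k) before and after this move, and [c k] is T(w) in the factor
    k. *)
Lemma exchange_prod (a b b' c : nat -> H) n :
  (forall k, (k < n)%N -> a k * b k * c k.+1 = c k * b' k * a k) ->
  (forall j k, (j < k < n)%N -> GRing.comm (a k) (b j)) ->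
  (forall j k, (j < k < n)%N -> GRing.comm (a j) (b' k)) ->
  (\prod_(0 <= i < n) a i) * (\prod_(0 <= i < n) b i) * c n
    = c 0%N * (\prod_(0 <= i < n) b' i) * \prod_(0 <= i < n) a i.
Proof.
elim: n => [|n IHn] abc cab cab'; first by rewrite !big_geq // !mul1r !mulr1.
have ca : GRing.comm (a n) (\prod_(0 <= i < n) b i).
  by rewrite big_nat; apply: commr_prod => i iln; apply: cab; rewrite ltnSn andbT.
have cb : GRing.comm (b' n) (\prod_(0 <= i < n) a i).
  rewrite big_nat; apply: commr_prod => i iln; apply: commr_sym; apply: cab'.
  by rewrite ltnSn andbT.
have {}IHn := IHn (fun k kn => abc k (ltnW kn)) _ _.
rewrite !big_nat_recr //= -!mulrA (mulrA (a n)) ca -(mulrA _ (a n)).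
rewrite (mulrA (a n)) abc // !mulrA IHn; first last.
- by move=> j k /andP[jk kn]; apply: cab'; rewrite jk ltnW.
- by move=> j k /andP[jk kn]; apply: cab; rewrite jk ltnW.
by rewrite -!mulrA (mulrA _ (b' n) (a n)) -cb -!mulrA.
Qed.

(** [x] stands for the product of the R(u_i, w), [z] and [z'] for P_(1..m) and P_(2..m+1), [y] and
    [y'] for the products of the T(u_i) before and after the exchange. Multiplying the exchange
    relation by [z'] yields f on the left at once, and on the right because [y'] lets [z'] through
    to [x]. *)
Lemma exchange_cancel (f z z' x y y' c c' : H) :
  central f -> GRing.lreg f -> GRing.comm z' c ->
  x * y * c' = c * y' * x -> z' * x = f * (z' * z) -> z' * y' = z' * y' * z' ->
  z' * z * y * c' = c * (z' * y' * (z' * z)).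
Proof.
move=> cf rf zc xyc zx zy; apply: rf.
rewrite !mulrA -(mulrA f z' z) -zx -!mulrA (mulrA x y) xyc !mulrA zc -!mulrA.
rewrite (mulrA z') zy -!mulrA zx !mulrA -(cf (c * z' * y')) !mulrA.
by rewrite -!mulrA.
Qed.

(** As z e = 0, t z = - z (e - t). The factor e - t, which is R - q in the application, passes
    through b_j b_(j+1) and meets e on the right, where (e - t) e = 0. *)
Lemma fusion_prod (t e z w : H) (b : nat -> H) n j :
  (j.+1 < n)%N -> z * e = 0 -> e * e = t * e -> central t -> GRing.lreg t ->
  (forall i, (i < n)%N -> i != j -> i != j.+1 -> GRing.comm e (b i)) ->
  (e - t) * (b j * b j.+1) = w * (e - t) ->
  z * (\prod_(0 <= i < n) b i) * e = 0.
Proof.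
move=> jn ze ee ct rt eb ebb; apply: rt; rewrite mulr0.
rewrite (big_cat_nat (n := j)) /=; [|by []|by lia].
rewrite (big_cat_nat (m := j) (n := j.+2)) /=; [|by lia|by lia].
rewrite big_nat_recl // big_nat1.
have c1 : GRing.comm e (\prod_(j.+2 <= i < n) b i).
  by rewrite big_nat; apply: commr_prod => i ij; apply: eb; lia.
have c2 : GRing.comm (e - t) (\prod_(0 <= i < j) b i).
  apply: commr_sym; apply: commrB; last by apply: commr_sym; apply: ct.
  apply: commr_sym; rewrite big_nat; apply: commr_prod => i ij; apply: eb; lia.
have tz : t * z = - (z * (e - t)) by rewrite mulrBr ze sub0r opprK ct.
have et : (e - t) * e = 0 by rewrite mulrBl ee subrr.
rewrite !mulrA tz !mulNr -(mulrA z (e - t)) c2 -!mulrA -c1.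
rewrite (mulrA (b j)) (mulrA (e - t)) ebb -!mulrA (mulrA (e - t)) et.
by rewrite mul0r !mulr0 oppr0.
Qed.

End Exchange.

(** * The RTT relation without denominators *)

Section QuadraticRTT.

Variables (H : pzRingType) (r h : H) (a b : nat -> H).
Hypothesis hC : central h.
Hypothesis rtt : forall k l,
  (r * a k * b l - h * \sum_(i < k.+1) a (k - i)%N * b (l + i)%N)
  - (a l * b k * r - h * \sum_(i < k.+1) a (l + i)%N * b (k - i)%N) = 0.

(** Passage from T(u) to u^-1 T(u). *)
Definition delay (f : nat -> H) k := if k is k'.+1 then f k' else 0.

(* The relation (u R^-1 - v R) T_1(u) T_2(v) = T_1(v) T_2(u) (u R^-1 - v R),
   multiplied by u^-1 v^-1; R^-1 = R - (q - q^-1). *)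
Lemma quadratic_rtt k l :
  (r - h) * a k * delay b l - r * delay a k * b l
    = delay a l * b k * (r - h) - a l * delay b k * r.
Proof.
pose S k l := \sum_(i < k.+1) a (k - i)%N * b (l + i)%N.
pose S' k l := \sum_(i < k.+1) a (l + i)%N * b (k - i)%N.
have rtt' i j : r * a i * b j - h * S i j = a j * b i * r - h * S' i j.
  by apply/eqP; rewrite -subr_eq0; apply/eqP; apply: rtt.
(* S and S' come from expanding u / (u - v). Multiplication by u - v telescopes these geometric sums
   and leaves one product of each. *)
have SS i j : S i.+1 j = a i.+1 * b j + S i j.+1.
  rewrite /S big_ord_recl subn0 addn0; congr (_ + _).
  by apply: eq_bigr => x _; rewrite lift0 subSS addSnnS.
have SS' i j : S' i.+1 j = a j * b i.+1 + S' i j.+1.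
  rewrite /S' big_ord_recl subn0 addn0; congr (_ + _).
  by apply: eq_bigr => x _; rewrite lift0 subSS addSnnS.
(* This settles the boundary l = 0, where [delay] vanishes: both sums consist of the same products
   in opposite order. *)
have S0 i : S i 0%N = S' i 0%N.
  rewrite /S /S' (reindex_inj rev_ord_inj) /=; apply: eq_bigr => x _.
  by rewrite subSS add0n subKn // -ltnS.
have red x y : (r - h) * x * y = r * x * y - h * (x * y).
  by rewrite !mulrBl mulrA.
have red' x y : x * y * (r - h) = x * y * r - h * (x * y).
  by rewrite mulrBr (hC (x * y)).
case: k l => [|k] [|l] /=; rewrite ?mulr0 ?mul0r ?subr0 ?sub0r ?oppr0 //.
- by have := rtt' 0%N l; rewrite /S /S' !big_ord1 !subn0 !addn0 red red'.
- have := rtt' k 0%N; rewrite S0 => /eqP; rewrite (inj_eq (addIr _)) => /eqP ->.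
  by [].
rewrite red red'; have := rtt' k.+1 l; have := rtt' k l.+1.
rewrite SS SS' !mulrDr !opprD !addrA => H1 H2.
have := congr2 (fun x y => y - x) H1 H2.
by rewrite !opprB ![_ + (h * _ - _)]addrA !subrK.
Qed.

End QuadraticRTT.

Section SeriesRTT.

Variables (K : fieldType) (H : pzRingType) (kap : {rmorphism K -> H}).
Hypothesis kapC : forall c, central (kap c).
Variables (r s : H) (a b : nat -> H).
Hypothesis rtt : forall k l,
  s * a k * delay b l - r * delay a k * b l
    = delay a l * b k * s - a l * delay b k * r.

(* T(c^-1 u) as a series in u^-1 *)
Definition dilate c (f : nat -> H) : series H := fun k => kap (c ^+ k) * f k.

Lemma dilate_delay c f :
  dilate c (delay f) = sconst (kap c) * svar H * dilate c f.
Proof.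
apply/funext => k; rewrite -mulrA sconstM svarM /dilate.
case: k => [|k] /=; first by rewrite !mulr0.
by rewrite mulrA -rmorphM -exprS.
Qed.

(** With u = c^-1 t and v = d^-1 t, the quadratic relation has a common factor t^-1, which is
    cancelled. This one-variable form is the one needed for fusion. *)
Lemma dilate_rtt c d :
  (sconst (kap d * s) - sconst (kap c * r)) * (dilate c a * dilate d b)
    = dilate d a * dilate c b * (sconst (kap d * s) - sconst (kap c * r)).
Proof.
have kS x : central (sconst (kap x)) by apply/central_sconst/kapC.
have vS := @central_svar H.
have main : sconst s * (dilate c a * dilate d (delay b))
      - sconst r * (dilate c (delay a) * dilate d b)
    = dilate d (delay a) * dilate c b * sconst s
      - dilate d a * dilate c (delay b) * sconst r.
  apply/funext => n.
  rewrite -[LHS]/(_ - (sconst r * (_ * _)) n) -[RHS]/(_ - (_ * _ * sconst r) n).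
  rewrite 2!sconstM 2!smul_sconst.
  rewrite !(coefsM (dilate c _)) 2![(dilate d _ * _) n]smul_rev.
  rewrite !big_distrr !big_distrl -!sumrB /=; apply: eq_bigr => i _.
  have pull x y z w : kap x * z * (kap y * w) = kap (x * y) * (z * w).
    by rewrite mulrA -(mulrA _ z) -(kapC y z) !mulrA -rmorphM -!mulrA.
  rewrite /dilate !pull (mulrC (d ^+ _)) !(mulrA s) !(mulrA r).
  rewrite -(kapC _ s) -(kapC _ r) -!(mulrA (kap _)) -!mulrBr.
  by rewrite !(mulrA s) !(mulrA r) rtt.
move: main; rewrite !dilate_delay.
have yS x : central (sconst (kap x) * svar H) by apply: centralM.
have push (y A B : series H) : central y -> A * (y * B) = y * (A * B).
  by move=> cy; rewrite !mulrA -(cy A).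
rewrite !(push _ _ _ (yS _)) -!(mulrA (sconst _ * _)) !(push _ _ _ (yS _)) => main.
apply: (@lreg_svar H); rewrite !rmorphM !(mulrBl, mulrBr).
rewrite !(push _ _ _ (kS _)) -!(mulrA (sconst (kap _)) (sconst _)).
by rewrite !(push _ _ _ (kS _)) !(mulrA (sconst (kap _)) (svar H)) main.
Qed.

(** T(c^-1 u) with u^-1 as the outer variable. The inner variable is reserved for the second
    parameter, so that nothing is specialized. *)
Definition dilate2 c (f : nat -> H) : series (series H) :=
  fun k => sconst (dilate c f k).

Definition var1 : series (series H) := svar (series H).
Definition var2 : series (series H) := sconst (svar H).
Definition const2 (x : H) : series (series H) := sconst (sconst x).

Lemma dilate2_rtt c :
  (var2 * const2 s - const2 (kap c) * var1 * const2 r)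
      * dilate2 c a * sconst (b : series H)
    = sconst (a : series H) * dilate2 c b
      * (var2 * const2 s - const2 (kap c) * var1 * const2 r).
Proof.
have v2C : central var2 by apply/central_sconst/central_svar.
have v1C : central var1 by apply: central_svar.
have kC x : central (const2 (kap x)) by do 2!apply: central_sconst.
have d1 f : const2 (kap c) * var1 * dilate2 c f = dilate2 c (delay f).
  apply/funext => k; rewrite -mulrA sconstM svarM /dilate2 /dilate.
  case: k => [|k] /=; first by rewrite !mulr0 rmorph0.
  by rewrite -rmorphM mulrA -rmorphM -exprS.
have d2 f : var2 * sconst (f : series H) = sconst (delay f : series H).
  rewrite -rmorphM; congr sconst; apply/funext => -[|k]; rewrite svarM //.
have kvC : central (const2 (kap c) * var1) by apply: centralM.
have -> : (var2 * const2 s - const2 (kap c) * var1 * const2 r) * dilate2 c a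
      * sconst (b : series H)
    = const2 s * dilate2 c a * sconst (delay b : series H)
      - const2 r * dilate2 c (delay a) * sconst (b : series H).
  rewrite !mulrBl -d1 -d2; congr (_ - _); last by rewrite (kvC (const2 r)) !mulrA.
  by rewrite mulrA -(v2C (const2 s * _)) !mulrA.
have -> : sconst (a : series H) * dilate2 c b
      * (var2 * const2 s - const2 (kap c) * var1 * const2 r)
    = sconst (delay a : series H) * dilate2 c b * const2 s
      - sconst (a : series H) * dilate2 c (delay b) * const2 r.
  rewrite mulrBr -d1 -d2; congr (_ - _).
    by rewrite mulrA -(v2C (_ * _)) !mulrA.
  by rewrite (mulrA (sconst _) (const2 _ * _)) -(kvC (sconst _)) (mulrA (_ * dilate2 c b)) -(kvC (sconst _ * _)) !mulrA.
apply/funext => k; apply/funext => l.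
have coefB (f g : series (series H)) : (f - g) k l = f k l - g k l by [].
rewrite !coefB.
rewrite !smul_sconst !sconstM !smul_sconst /dilate2 /dilate -!rmorphM !sconstM.
have push x y : x * (kap (c ^+ k) * y) = kap (c ^+ k) * (x * y).
  by rewrite !mulrA -(kapC _ x).
rewrite !push -!(mulrA (kap _)) -!mulrBr.
by rewrite rtt.
Qed.

End SeriesRTT.

(** * The quantum determinant *)

Section Morphisms.

Variables (K : fieldType) (H H' : pzRingType).
Variables (kap : {rmorphism K -> H}) (f : {rmorphism H -> H'}) (q : K).

Lemma hecke_gens_map L e : hecke_gens kap q L e ->
  hecke_gens (f \o kap : {rmorphism K -> H'}) q L (f \o e).
Proof.
case=> eQ eB eC; split=> [i iL|i iL|i j ij jL] /=.
- by rewrite -!rmorphM eQ.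
- by rewrite -!rmorphM -!rmorphB eB.
- by rewrite /GRing.comm -!rmorphM eC.
Qed.

Lemma antisym_map e s k :
  antisym (f \o kap : {rmorphism K -> H'}) q (f \o e) s k = f (antisym kap q e s k).
Proof.
elim: k => [|k IHk]; first by rewrite /= rmorph1.
by rewrite !antisymS rmorphB !rmorphM IHk.
Qed.

End Morphisms.

Section OverAlgebra.

Variables (K : fieldType) (N : nat) (A : algType K).

Definition scalm n : {rmorphism tensor_op K N n.+1 -> tensor_op A N n.+1} :=
  map_mx (in_alg A).

Definition kapA n : {rmorphism K -> tensor_op A N n.+1} :=
  scalm n \o @scalar_mx K _.

Lemma kapAE n c : kapA n c = (c%:A)%:M.
Proof. by rewrite /kapA /= map_scalar_mx. Qed.

Lemma in_algC c (x : A) : GRing.comm (c%:A) x.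
Proof. by rewrite /GRing.comm mulr_algl mulr_algr. Qed.

Lemma kapAM n c (X : tensor_op A N n.+1) : kapA n c * X = c%:A *: X.
Proof. by rewrite kapAE [LHS]mul_scalar_mx. Qed.

Lemma kapA_central n c : central (kapA n c).
Proof.
move=> X; rewrite /GRing.comm kapAM kapAE; apply/matrixP => i j.
rewrite !mxE (bigD1 j) //= !mxE eqxx big1 ?addr0 => [|k /negPf kj]; last first.
  by rewrite !mxE kj mulr0.
exact: in_algC.
Qed.

End OverAlgebra.

(** * Fusion and the determinant in an arbitrary algebra with RTT matrices *)

Section RTTAlgebra.

Variables (K : fieldType) (N : nat) (q : K) (R : tensor_op K N 2).
Hypothesis hq : generic q.
Hypothesis hR : hecke_symmetry q R.
Variables (A : algType K) (T : nat -> 'M[A]_N).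
Hypothesis hT : forall k l, rtt_coef q R T k l = 0.

Local Notation sc n := (@scalm K N A n).
Local Notation kap n := (@kapA K N A n).

Definition egenA n j : tensor_op A N n.+1 := sc n (egen q R n j).
Definition leg n j k : tensor_op A N n.+1 := place1 (inord j) (T k).

Lemma egenA_hecke n : hecke_gens (kap n) q n (egenA n).
Proof. exact: hecke_gens_map (egen_hecke hq hR n). Qed.

Lemma antisymA n s k : (s + k <= n.+1)%N ->
  antisym (kap n) q (egenA n) s k
    = sc n (place (shift_pos n s k) (skew_symmetrizer q R k)).
Proof.
move=> skn; rewrite (place_skew_symmetrizer hq hR) //.
exact: (antisym_map _ (sc n)).
Qed.

Lemma egenA_leg n i j k : (i < n)%N -> (j <= n)%N -> j != i -> j != i.+1 ->
  GRing.comm (egenA n i) (leg n j k).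
Proof.
move=> iltn jn ji ji1; rewrite /egenA /egen rmorphD; apply: commr_sym.
apply: commrD; last by apply: commr_sym; apply: (kapA_central (n := n)).
apply: commr_sym.
have -> : leg n j k = place [tuple inord j] (place1 (ord0 : 'I_1) (T k)).
  by rewrite place_place1.
rewrite /scalm /= place_map; apply: place_comm => //.
- rewrite /= inE andbT -(inj_eq val_inj) /= !inordK; lia.
- move=> x; rewrite !inE => /orP[] /eqP ->;
  by rewrite -(inj_eq val_inj) /= !inordK; lia.
- by move=> a b c d; rewrite coef_map; apply: in_algC.
Qed.

Lemma leg_rtt n j k l : (j < n)%N ->
  sc n (adj n j R - (q - q^-1)%:M) * leg n j k * delay (leg n j.+1) l
    - sc n (adj n j R) * delay (leg n j) k * leg n j.+1 l
  = delay (leg n j) l * leg n j.+1 k * sc n (adj n j R - (q - q^-1)%:M)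
    - leg n j l * delay (leg n j.+1) k * sc n (adj n j R).
Proof.
move=> jn; rewrite rmorphB /=.
apply: quadratic_rtt => [|{}k {}l]; first exact: (kapA_central (n := n)).
have us : uniq (shift_pos n j 2) by apply: shift_uniq; lia.
have t1 x : place (shift_pos n j 2) (place1 ord0 (T x)) = leg n j x.
  by rewrite place_place1 // tnth_shift addn0.
have t2 x : place (shift_pos n j 2) (place1 ord_max (T x)) = leg n j.+1 x.
  by rewrite place_place1 // tnth_shift addn1.
have := congr1 (place (shift_pos n j 2)) (hT k l).
have psum := big_morph (place (shift_pos n j 2)) (@placeD _ A _ _ _) (@place0 _ A _ _ _).
rewrite place0 /rtt_coef !(placeD, placeN) !placeZ !psum !placeM // !t1 !t2.
rewrite /scal_mx -place_map -adj_shift.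
rewrite (eq_bigr (fun i : 'I_k.+1 => leg n j (k - i)%N * leg n j.+1 (l + i)%N)); last first.
  by move=> i _; rewrite placeM // t1 t2.
rewrite [X in _ - (_ - _ *: X)](eq_bigr (fun i : 'I_k.+1 => leg n j (l + i)%N * leg n j.+1 (k - i)%N)); last first.
  by move=> i _; rewrite placeM // t1 t2.
by rewrite -!kapAM.
Qed.

Definition Tprod m k : tensor_op A N m :=
  \sum_(d : {ffun 'I_m -> 'I_k.+1} | (\sum_(i < m) d i)%N == k)
    \prod_(i < m) ((q ^+ (2 * i * d i))%:A *: place1 i (T (d i))).

Definition Tseries n s m :=
  \prod_(0 <= i < m) dilate (kap n) (q ^+ (2 * i)) (leg n (s + i)).

Lemma coefs_Tseries n s m k : (s + m <= n.+1)%N ->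
  Tseries n s m k = place (shift_pos n s m) (Tprod m k).
Proof.
move=> smn; have us := shift_uniq smn; rewrite /Tseries coefs_prod.
rewrite (big_morph (place (shift_pos n s m)) (@placeD _ A _ _ _) (@place0 _ A _ _ _)).
apply: eq_bigr => d _.
have pm (X Y : tensor_op A N m) : place (shift_pos n s m) (X * Y)
    = place (shift_pos n s m) X * place (shift_pos n s m) Y by apply: placeM.
rewrite (big_morph _ pm (@place_scalar N A _ _ (shift_pos n s m) 1)).
apply: eq_bigr => i _; rewrite /dilate placeZ place_place1 // tnth_shift.
by rewrite -exprM kapAM.
Qed.

Lemma Tseries_fusion n s m z j : (s + m <= n.+1)%N -> (j.+1 < m)%N ->
  z * sconst (egenA n (s + j)) = 0 ->
  z * Tseries n s m * sconst (egenA n (s + j)) = 0.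
Proof.
move=> smn jm ze; have q0 := generic_neq0 hq.
have [eQ _ _] := egenA_hecke n.
have unitl c : c != 0 -> GRing.lreg (sconst (kap n c)).
  move=> c0 x y E; have inv : sconst (kap n c^-1) * sconst (kap n c) = 1.
    by rewrite -!rmorphM mulVf // !rmorph1.
  by rewrite -[x]mul1r -[y]mul1r -inv -!mulrA E.
have kC c : central (sconst (kap n c)) by apply/central_sconst/kapA_central.
(* Otherwise q^2 = -1 and q^4 = 1. Fusion cancels q + q^-1. *)
have qq : q + q^-1 != 0.
  apply/eqP => E; have := generic_expr_neq1 hq (isT : 0 < 4)%N.
  have /eqP : q * (q + q^-1) = 0 by rewrite E mulr0.
  rewrite mulrDr divff // addr_eq0 -expr2 => /eqP q2.
  by rewrite -[4%N]/(2 * 2)%N exprM q2 sqrrN expr1n eqxx.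
pose c := q ^+ (2 * j); pose g := c * (q ^+ 2 - 1).
have g0 : g != 0.
  by rewrite mulf_neq0 ?expf_neq0 // subr_eq0 (generic_expr_neq1 hq).
have sj : (s + j < n)%N by lia.
have rttS := dilate_rtt (kapA_central (n := n)) (fun k l => leg_rtt k l sj).
pose b i := dilate (kap n) (q ^+ (2 * i)) (leg n (s + i)).
apply: (fusion_prod (t := sconst (kap n (q + q^-1))) (b := b) (j := j)
  (w := dilate (kap n) (q ^+ (2 * j.+1)) (leg n (s + j))
        * dilate (kap n) c (leg n (s + j).+1))) => //.
- by rewrite -rmorphM eQ // rmorphM.
- exact: unitl.
- move=> i im ij ij1; apply/funext => x; rewrite sconstM smul_sconst /b /dilate.
  rewrite mulrA -(kapA_central _ (egenA _ _)) -!mulrA; congr (_ * _).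
  by apply: egenA_leg; rewrite ?addnS ?eqn_add2l ?eqSS //; lia.
(* For parameters of ratio q^2 the combination q^(2j) (q^2 R^-1 - R) collapses to g (R - q), and R -
   q = e - (q + q^-1). *)
have E : kap n (q ^+ (2 * j.+1)) * sc n (adj n (s + j) R - (q - q^-1)%:M)
     - kap n c * sc n (adj n (s + j) R)
   = kap n g * (egenA n (s + j) - kap n (q + q^-1)).
  have -> : sc n (adj n (s + j) R) = egenA n (s + j) - kap n q^-1.
    by rewrite /egenA /egen rmorphD addrK.
  have -> : sc n (adj n (s + j) R - (q - q^-1)%:M)
      = egenA n (s + j) - kap n q.
    have -> : kap n q = kap n q^-1 + kap n (q - q^-1) by rewrite -rmorphD subrKC.
    rewrite /egenA /egen (rmorphB (sc n)) (rmorphD (sc n) (adjacent _ _ _)).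
    rewrite opprD addrA; congr (_ - _); exact: esym (addrK (kap n q^-1) _).
  have -> : kap n g = kap n (q ^+ (2 * j.+1)) - kap n c.
    rewrite -rmorphB; congr (kap n _).
    by rewrite /g /c mulnS exprD; ring.
  rewrite !mulrBl !mulrBr -!rmorphM !opprD !opprK addrACA [RHS]addrACA.
  congr (_ + _); rewrite -!rmorphN -!rmorphD /=; congr (kap n _).
  by rewrite /c mulnS exprD; field.
have hw := rttS c (q ^+ (2 * j.+1)); rewrite -!rmorphB E rmorphM in hw.
apply: (unitl g g0); rewrite /b addnS -rmorphB.
by rewrite [LHS]mulrA; etransitivity; [exact: hw | rewrite [RHS]mulrA (kC g (_ * _)) -[RHS]mulrA].
Qed.

Section TopAntisymmetrizer.

Variable m : nat.
Local Notation Pm := (skew_symmetrizer q R m.+1).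

Lemma Tprod_fusion k :
  scal_mx Pm *m Tprod m.+1 k = scal_mx Pm *m Tprod m.+1 k *m scal_mx Pm
    :> tensor_op A N m.+1.
Proof.
have PE : scal_mx Pm = antisym (kap m) q (egenA m) 0 m.+1.
  by rewrite antisymA // place_id.
have kC := @kapA_central K N A m.
rewrite -[RHS]/((_ * Tprod m.+1 k) * scal_mx Pm) PE (antisym_absorb q kC) // => j _ jm.
rewrite -[Tprod _ _]place_id -coefs_Tseries //.
have := @Tseries_fusion m 0 m.+1 (sconst (antisym (kap m) q (egenA m) 0 m.+1)) j.
rewrite !add0n => /(_ (ltnSn m) jm).
have -> : sconst (antisym (kap m) q (egenA m) 0 m.+1) * sconst (egenA m j) = 0.
  rewrite -rmorphM (antisym_genr kC hq (egenA_hecke m)) ?rmorph0 //.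
move=> /(_ erefl) /(congr1 (fun f : series _ => f k)).
by rewrite smul_sconst sconstM.
Qed.

Variables (u v : m.+1.-tuple 'I_N -> K).
Hypothesis huv : forall a b, coef Pm a b = u a * v b.

(* The scalar D_k such that P T_1(u) ... T_m(q^(-2(m-1)) u) = \sum_k u^-k D_k P *)
Definition qdet k : A :=
  \sum_I \sum_J (v I)%:A * coef (Tprod m.+1 k) I J * (u J)%:A.

(** By fusion the left side has the form P X P, and P X P = (v X u) P because P has the entries u_a
    v_b. *)
Lemma Tprod_qdet k : scal_mx Pm *m Tprod m.+1 k = qdet k *: scal_mx Pm.
Proof.
rewrite Tprod_fusion; apply: tensor_eqP => a b; rewrite coefZ coefM /qdet.
rewrite big_distrl; under [RHS]eq_bigr => I _ do rewrite big_distrl /=.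
rewrite [RHS]exchange_big /=; apply: eq_bigr => J _.
rewrite coefM big_distrl /=; apply: eq_bigr => I _.
rewrite !coef_map !huv /= !(mulr_algl, mulr_algr) !scalerA.
by congr (_ *: _); ring.
Qed.

End TopAntisymmetrizer.

End RTTAlgebra.

(** * Moving T(w) through the product of the T(u_i) *)

Section Exchange.

Variables (K : fieldType) (N m : nat) (q : K) (R : tensor_op K N 2).
Hypothesis hq : generic q.
Hypothesis hR : hecke_symmetry q R.
Hypothesis Pm2 : skew_symmetrizer q R m.+2 = 0.
Hypothesis Pm0 : skew_symmetrizer q R m.+1 <> 0.
Variables (A : algType K) (T : nat -> 'M[A]_N).
Hypothesis hT : forall k l, rtt_coef q R T k l = 0.

Local Notation n := m.+1.
Local Notation Pm := (skew_symmetrizer q R m.+1).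
Local Notation P := (place (shift_pos n 0 n) Pm).
Local Notation P' := (place (shift_pos n 1 n) Pm).

Let tail_le : (1 + n <= n.+1)%N. Proof. by []. Qed.

Lemma place_neq0 : P' <> 0.
Proof.
move=> P0; apply: Pm0; apply: tensor_eqP => I J; rewrite [RHS]mxE.
pose i := thead I; have := congr1 (fun X => coef X (cons_tuple i I) (cons_tuple i J)) P0.
by rewrite coef_place_tail eqxx => ->; rewrite /coef mxE.
Qed.

Lemma cycle_scalar : exists c : K,
  [/\ P' * (\prod_(0 <= i < n) egen q R n i) * P = c%:M * (P' * P),
      P' * P <> 0 & (- q) ^+ n + c != 0].
Proof.
have kC a : central (a%:M : tensor_op K N n.+1) by move=> y; apply/esym/scalar_mxC.
have he := egen_hecke hq hR n.
have E s := @place_skew_symmetrizer K N q R hq hR n s n.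
have [c hc] := antisym_cycle kC hq he (ltn0Sn m) (etrans (esym (skew_symmetrizerE hq hR n)) Pm2).
rewrite -!E // in hc; exists c; have := @antisym_cycle_neq0 _ _ _ _ _ _ kC hq he (ltn0Sn m) c.
by rewrite -!E // => /(_ place_neq0 hc) [? ?]; split.
Qed.

Local Notation B := (tensor_op A N n.+1).
Local Notation S := (series (series B)).

Let f2 : {rmorphism tensor_op K N n.+1 -> S} :=
  @sconst (series B) \o (@sconst B \o @scalm K N A n).
Let f2E X : f2 X = sconst (sconst (@scalm K N A n X)). Proof. by []. Qed.
Let kapS : {rmorphism K -> S} := f2 \o @scalar_mx K _.
Let x : S := svar (series B).
Let y : S := sconst (svar B).

Let kC c : central (kapS c).
Proof. by apply/central_sconst/central_sconst/kapA_central. Qed.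
Let xC : central x. Proof. exact: central_svar. Qed.
Let yC : central y. Proof. exact/central_sconst/central_svar. Qed.

Let al := spec_al kapS q x y.
Let ga := spec_ga kapS q x y.
Let eS i : S := f2 (egen q R n i).

Let alC i : central (al i). Proof. exact: spec_alC. Qed.
Let gaC i : central (ga i). Proof. exact: spec_gaC. Qed.

Let heS : hecke_gens kapS q n eS.
Proof. exact: hecke_gens_map (egen_hecke hq hR n). Qed.

Let legS s i : S := dilate2 (@kapA K N A n) (q ^+ (2 * i)) (leg T n (s + i)).

Lemma coefs_legS s k : (s + n <= n.+1)%N ->
  (\prod_(0 <= i < n) legS s i) k = sconst (place (shift_pos n s n) (Tprod q T n k)).
Proof.
move=> sn; rewrite -(coefs_Tseries q T k sn) /Tseries !coefs_prod rmorph_sum.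
by apply: eq_bigr => d _; rewrite rmorph_prod.
Qed.

Let antisym_f2 s : (s + n <= n.+1)%N ->
  antisym kapS q eS s n = f2 (place (shift_pos n s n) Pm).
Proof.
move=> sn; rewrite (place_skew_symmetrizer hq hR) //.
exact: (antisym_map _ f2).
Qed.

Lemma fusion_legS s : (s + n <= n.+1)%N ->
  f2 (place (shift_pos n s n) Pm) * \prod_(0 <= i < n) legS s i
    = f2 (place (shift_pos n s n) Pm) * \prod_(0 <= i < n) legS s i
        * f2 (place (shift_pos n s n) Pm).
Proof.
move=> sn; apply/funext => k; rewrite f2E smul_sconst !sconstM coefs_legS // -!rmorphM.
congr sconst; have us := shift_uniq sn.
have -> : scalm N A n (place (shift_pos n s n) Pm)
    = place (shift_pos n s n) (scal_mx Pm) by rewrite /scal_mx -place_map.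
have := congr1 (place (shift_pos n s n)) (Tprod_fusion hq hR hT m k).
by rewrite !placeM.
Qed.

(** The same Baxterized factor in two forms: on the left in terms of e, as fusion needs it, on the
    right as w^-1 R^-1 - u_i^-1 R, as the RTT relation needs it. *)
Let E_al i : al i * eS i + ga i =
  var2 B * const2 (scalm N A n (adj n i R - (q - q^-1)%:M))
  - const2 (@kapA K N A n (q ^+ (2 * i))) * var1 B * const2 (scalm N A n (adj n i R)).
Proof.
rewrite -/x -/y -[const2 (scalm N A n (adj _ _ _))]/(f2 (adj n i R)).
rewrite -[const2 (scalm N A n (_ - _))]/(f2 (adj n i R - (q - q^-1)%:M)).
rewrite -[const2 (@kapA K N A n _)]/(kapS (q ^+ (2 * i))) /eS /egen.
rewrite (rmorphD f2 (adjacent n i R)) (rmorphB f2 (adj n i R)).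
rewrite -[adjacent n i R]/(adj n i R) -[f2 (q^-1)%:M]/(kapS q^-1).
rewrite -[f2 (q - q^-1)%:M]/(kapS (q - q^-1)) /al /ga /spec_al /spec_ga.
set r := f2 _; set a := q ^+ _.
have -> : kapS (q^-1 * a) * x = kapS a * x * kapS q^-1.
  by rewrite rmorphM -mulrA (kC q^-1 (kapS a * x)).
have -> : kapS q * y = y * kapS q by rewrite (kC q y).
rewrite -/x -/y (rmorphB kapS) mulrDr -addrA mulrBl [X in _ + (X + _)]mulrBl subrKA.
by rewrite mulrBr [y * (_ - _)]mulrBr opprB addrAC.
Qed.

Lemma exchange_qdet k l :
  @scalm K N A n (P' * P) * place (shift_pos n 0 n) (Tprod q T n k)
      * leg T n n l
    = leg T n 0 l * (@scalm K N A n P' * place (shift_pos n 1 n) (Tprod q T n k)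
      * @scalm K N A n (P' * P)).
Proof.
have [c [hc PP0 c0]] := cycle_scalar.
have q0 := generic_neq0 hq.
pose z := f2 P; pose z' := f2 P'.
have hcS : antisym kapS q eS 1 n * (\prod_(0 <= i < n) eS i) * antisym kapS q eS 0 n
    = kapS c * (antisym kapS q eS 1 n * antisym kapS q eS 0 n).
  by rewrite !antisym_f2 // -!rmorph_prod -!rmorphM hc; exact: (rmorphM f2).
have := antisym_baxter kC hq heS (ltn0Sn m) alC gaC (fun j _ => spec_cond kC q0 xC yC j) hcS.
rewrite !antisym_f2 // -/z -/z'.
set f := _ + _ * kapS c => zX.
have fC : central f.
  by apply: centralD; [|apply: centralM => //]; apply: central_prod.
(* At u^-1 = 0 each [ga i] becomes -q w^-1 and each [al i] becomes w^-1. The constant term of f is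
   thus ((-q)^n + c) w^-n, an invertible scalar times a power of the inner variable. *)
have fR : GRing.lreg f.
  apply: lreg_series; rewrite /f rmorphD rmorphM !rmorph_prod /=.
  have ga0 i : coefs0 (ga i) = sconst (@kapA K N A n (- q)) * svar B.
    rewrite -[LHS]/((kapS _ * x) 0%N - (kapS q * y) 0%N) !coefs0M.
    by rewrite mulr0 sub0r -mulNr -[kapS q 0%N]/(sconst (@kapA K N A n q)) -!rmorphN.
  have al0 i : coefs0 (al i) = svar B.
    by rewrite -[LHS]/(y 0%N - (kapS _ * x) 0%N) !coefs0M mulr0 subr0.
  have k0 d : coefs0 (kapS d) = sconst (@kapA K N A n d) by [].
  have prod_const w : \prod_(0 <= i < n) w = w ^+ n :> series B.
    by rewrite big_const_nat subn0 iter_mulr mulr1.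
  rewrite (eq_bigr _ (fun i _ => ga0 i)) (eq_bigr _ (fun i _ => al0 i)).
  rewrite !prod_const k0 exprMn_comm; last exact/central_sconst/kapA_central.
  rewrite -(central_sconst (@kapA_central K N A n c) (_ ^+ _ : series B)).
  rewrite -mulrDl -!rmorphXn -!rmorphD /=; apply: lregM; last exact/lregX/lreg_svar.
  move=> f1 f3 E; have inv : sconst (@kapA K N A n ((- q) ^+ n + c)^-1)
      * sconst (@kapA K N A n ((- q) ^+ n + c)) = 1.
    by rewrite -!rmorphM mulVf // !rmorph1.
  by rewrite -[f1]mul1r -[f3]mul1r -inv -!mulrA E.
have zy := fusion_legS tail_le.
have legC i j s : (i < n)%N -> (s + j <= n)%N -> (s + j)%N != i -> (s + j)%N != i.+1 ->
    GRing.comm (eS i) (legS s j).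
  move=> iltn jn ji ji1; apply/funext => d; rewrite /eS f2E sconstM smul_sconst /legS /dilate2 /dilate.
  rewrite -!rmorphM; congr sconst; rewrite mulrA -(kapA_central _ (scalm _ _ _ _)) -!mulrA.
  by congr (_ * _); apply: egenA_leg.
have ex : (\prod_(0 <= i < n) (al i * eS i + ga i)) * (\prod_(0 <= i < n) legS 0 i)
      * sconst (leg T n n : series B)
    = sconst (leg T n 0 : series B) * (\prod_(0 <= i < n) legS 1 i)
      * \prod_(0 <= i < n) (al i * eS i + ga i).
  apply: (exchange_prod (c := fun i => sconst (leg T n i : series B))).
  - move=> i iltn; rewrite E_al.
    exact: (dilate2_rtt (kapA_central (n := n)) (fun k l => leg_rtt hT k l iltn)).
  - move=> j i /andP[ji iltn]; apply: commr_sym; apply: commrD.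
      apply: commrM; first by apply: commr_sym; apply: alC.
      by apply: commr_sym; apply: legC; rewrite ?add0n; lia.
    by apply: commr_sym; apply: gaC.
  - move=> j i /andP[ji iltn]; apply: commr_sym; apply: commrD.
      apply: commrM; first by apply: commr_sym; apply: alC.
      by apply: commr_sym; apply: legC; rewrite ?add1n; lia.
    by apply: commr_sym; apply: gaC.
have zc : GRing.comm z' (sconst (leg T n 0 : series B)).
  rewrite /GRing.comm /z' f2E -!rmorphM; congr sconst; apply/funext => d.
  rewrite sconstM smul_sconst /scalm /= place_map.
  have -> : leg T n 0 d = place [tuple inord 0] (place1 (ord0 : 'I_1) (T d)).
    by rewrite place_place1.
  apply: place_comm => //; first exact: shift_uniq.
    move=> w; rewrite inE; apply: contraL => /eqP ->; rewrite notin_tail.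
    by apply/eqP/val_inj; rewrite /= inordK.
  by move=> *; rewrite coef_map; apply: in_algC.
have := exchange_cancel fC fR zc ex zX zy.
move=> /(congr1 (fun g : S => g k l)).
rewrite -rmorphM /z' !f2E !(smul_sconst, sconstM) !coefs_legS // -!rmorphM.
by rewrite sconstM smul_sconst.
Qed.

End Exchange.

(** * The determinant and the matrix M *)

Section QuantumDeterminant.

Variables (K : fieldType) (N m : nat) (q : K) (R : tensor_op K N 2).
Hypothesis hq : generic q.
Hypothesis hR : hecke_symmetry q R.
Hypothesis Pm2 : skew_symmetrizer q R m.+2 = 0.
Local Notation n := m.+1.
Local Notation Pm := (skew_symmetrizer q R m.+1).
Hypothesis Pm0 : Pm <> 0.
Variables u v : n.-tuple 'I_N -> K.
Hypothesis huv : forall a b, coef Pm a b = u a * v b.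

Local Notation P := (place (shift_pos n 0 n) Pm).
Local Notation P' := (place (shift_pos n 1 n) Pm).
Local Notation M := (contraction u v).

Lemma uv_neq0 : exists I J, u I * v J != 0.
Proof.
have [//|H] := pselect (exists I J, u I * v J != 0); exfalso; apply: Pm0.
apply: tensor_eqP => a b; rewrite huv [RHS]mxE; apply/eqP/negbNE/negP => uv0.
by apply: H; exists a, b.
Qed.

Lemma contraction_neq0 : M != 0.
Proof.
have [c [_ PP _]] := cycle_scalar hq hR Pm2 Pm0.
apply/eqP => M0; apply: PP; apply: tensor_eqP => a b.
rewrite -(cons_tail a) -(rcons_init b) (coef_contraction _ _ _ _ huv) M0 mxE mulr0.
by rewrite [RHS]mxE.
Qed.

Variables (A : algType K) (T : nat -> 'M[A]_N).
Hypothesis hT : forall k l, rtt_coef q R T k l = 0.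

Local Notation D := (qdet q T u v).
Local Notation sc := (@scalm K N A n).

Lemma scalmZ d (X Y : tensor_op K N n.+1) : sc X *m (d *: sc Y) = d *: sc (X *m Y).
Proof.
apply: tensor_eqP => a b; rewrite coefZ coefM coef_map coefM rmorph_sum big_distrr.
apply: eq_bigr => c _; rewrite coefZ !coef_map mulrA (in_algC _ d) -mulrA.
by rewrite rmorphM.
Qed.

Lemma place_qdet s k : (s + n <= n.+1)%N ->
  sc (place (shift_pos n s n) Pm) *m place (shift_pos n s n) (Tprod q T n k)
    = D k *: sc (place (shift_pos n s n) Pm).
Proof.
move=> sn; rewrite /scalm /= !place_map -placeM ?shift_uniq //.
by rewrite (Tprod_qdet hq hR hT huv) placeZ.
Qed.

Lemma qdet_exchange k l :
  D k *: (sc (P' *m P) *m place1 ord_max (T l))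
    = place1 ord0 (T l) *m (D k *: sc (P' *m P)).
Proof.
have := exchange_qdet hq hR Pm2 Pm0 hT k l.
have -> : leg T n n l = place1 ord_max (T l).
  by congr place1; apply: val_inj; rewrite /= inordK.
have -> : leg T n 0 l = place1 ord0 (T l).
  by congr place1; apply: val_inj; rewrite /= inordK.
have PP' : P' *m P' = P'.
  rewrite (place_skew_symmetrizer hq hR) //.
  apply: (antisym_idem _ hq (egen_hecke hq hR n)) => //.
  by move=> a X; apply/esym/scalar_mxC.
have -> : sc (P' * P) * place (shift_pos n 0 n) (Tprod q T n k) = D k *: sc (P' *m P).
  rewrite rmorphM -mulrA [X in _ * X]place_qdet //; rewrite -(rmorphM sc P' P).
  exact: scalmZ.
have -> : sc P' * place (shift_pos n 1 n) (Tprod q T n k) = D k *: sc P'.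
  exact: place_qdet.
have -> : (D k *: sc P') * sc (P' * P) = D k *: sc (P' *m P).
  rewrite -[LHS]scalemxAl; congr (_ *: _); rewrite -[LHS]rmorphM; congr (sc _).
  by rewrite -[LHS]/(P' *m (P' *m P)) mulmxA PP'.
by rewrite -[LHS]/((_ *: _) *m _) -scalemxAl.
Qed.

(** By [coef_contraction] both sides of [qdet_exchange] carry the factor u_I v_J. At a pair I, J
    where it is nonzero, it cancels and only the indices of M and T remain. *)
Lemma qdet_contraction k l i j :
  D k * (\sum_s (M i s)%:A * T l s j) = (\sum_s T l i s * (M s j)%:A) * D k.
Proof.
have [I [J uv0]] := uv_neq0.
have scC s t I' J' : coef (sc (P' *m P)) (cons_tuple s I') (rcons_tuple J' t)
    = (u I' * v J' * M s t)%:A by rewrite coef_map (coef_contraction _ _ _ _ huv).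
have := congr1 (fun X => coef X (cons_tuple i I) (rcons_tuple J j)) (qdet_exchange k l).
move: scC; set Q := sc _ => scC; clearbody Q.
rewrite coefZ.
have -> : coef (Q *m place1 ord_max (T l)) (cons_tuple i I) (rcons_tuple J j)
    = (u I * v J)%:A * \sum_s (M i s)%:A * T l s j.
  rewrite coefM sum_rcons (bigD1 J) //= [X in _ + X]big1 ?addr0 => [|J' /negPf JJ]; last first.
    by apply: big1 => s _; rewrite coef_place1_max JJ mulr0.
  rewrite big_distrr; apply: eq_bigr => s _ /=.
  by rewrite scC coef_place1_max eqxx mulrA -(rmorphM (in_alg A)).
have -> : coef (place1 ord0 (T l) *m (D k *: Q)) (cons_tuple i I) (rcons_tuple J j)
    = (u I * v J) *: ((\sum_s T l i s * (M s j)%:A) * D k).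
  rewrite coefM sum_cons scalerAl scaler_sumr big_distrl; apply: eq_bigr => s _ /=.
  rewrite (bigD1 I) //= big1 ?addr0 => [|I' /negPf II]; last first.
    by rewrite coef_place1_0 eq_sym II mul0r.
  rewrite coef_place1_0 eqxx coefZ scC !mulr_algr -!scalerAr -!scalerAl.
  by rewrite !scalerA.
by rewrite mulr_algl -scalerAr => /(scalerI uv0).
Qed.

Lemma det_coef_qdet (Psi : tensor_op K N 2) k :
  det_coef q R Psi T n k = rtrace Psi Pm *: D k.
Proof.
rewrite /det_coef.
have RD (X Y : tensor_op A N n) : Rtrace Psi (X + Y) = Rtrace Psi X + Rtrace Psi Y.
  by rewrite /Rtrace mulmxDl mxtraceD.
have R0 : Rtrace Psi (0 : tensor_op A N n) = 0 by rewrite /Rtrace mul0mx mxtrace0.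
rewrite -(big_morph _ RD R0) -mulmx_sumr -/(Tprod _ _ _ _) (Tprod_qdet hq hR hT huv).
by rewrite /Rtrace -scalemxAl mxtraceZ /scal_mx -map_mxM trace_map_mx mulr_algr.
Qed.

End QuantumDeterminant.

(** * The Yangian and its representations *)

Section Naturality.

Variables (K : fieldType) (N : nat) (q : K) (R : tensor_op K N 2).

Lemma place1_map (A B : nmodType) (f : {additive A -> B}) n (k : 'I_n)
    (X : 'M[A]_N) : map_mx f (place1 k X) = place1 k (map_mx f X).
Proof.
apply: tensor_eqP => a b; rewrite coef_map !coef_place1 mxE.
by case: ifP; rewrite ?raddf0.
Qed.

Section Lalg.
Variables (A A' : lalgType K) (f : {rmorphism A -> A'}).
Hypothesis fZ : forall c, f c%:A = c%:A.
Variable T : nat -> 'M[A]_N.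

Lemma scal_mx_map p r (X : 'M[K]_(p, r)) : map_mx f (scal_mx X) = scal_mx X.
Proof. by apply/matrixP => i j; rewrite !mxE; apply: fZ. Qed.

Lemma rtt_coef_map k l : map_mx f (rtt_coef q R T k l)
  = rtt_coef q R (fun k => map_mx f (T k)) k l.
Proof.
rewrite /rtt_coef !map_mxB !map_mxZ !map_mxM !scal_mx_map !place1_map fZ.
rewrite !raddf_sum /=.
by congr (_ + _ - (_ + _)); apply: eq_bigr => i _; rewrite map_mxM !place1_map.
Qed.

End Lalg.

Section Alg.
Variables (A A' : algType K) (f : {rmorphism A -> A'}).
Hypothesis fZ : forall c, f c%:A = c%:A.
Variable T : nat -> 'M[A]_N.

Lemma Tprod_map m k : map_mx f (Tprod q T m k) = Tprod q (fun k => map_mx f (T k)) m k.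
Proof.
rewrite /Tprod raddf_sum; apply: eq_bigr => d _ /=.
have f1 : map_mx f (1 : tensor_op A N m) = 1 by apply: map_mx1.
have fM (X Y : tensor_op A N m) : map_mx f (X * Y) = map_mx f X * map_mx f Y.
  by apply: map_mxM.
rewrite (big_morph _ fM f1); apply: eq_bigr => i _.
by rewrite map_mxZ fZ place1_map.
Qed.

Lemma qdet_map m (u v : m.+1.-tuple 'I_N -> K) k :
  f (qdet q T u v k) = qdet q (fun k => map_mx f (T k)) u v k.
Proof.
rewrite /qdet rmorph_sum; apply: eq_bigr => I _; rewrite rmorph_sum.
apply: eq_bigr => J _; rewrite !rmorphM; congr (_ * _ * _); try exact: fZ.
by rewrite -Tprod_map coef_map.
Qed.

End Alg.

End Naturality.

(** * Universal property of the Yangian *)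

Section Yangian.

Variables (K : fieldType) (N : nat) (q : K) (R : tensor_op K N 2).

Local Notation Y := (yangian q R).
Local Notation free := {malg K[{fmonom (nat * 'I_N * 'I_N)%type}]}.

Definition piY : free -> Y := \pi_Y%qT.

Fact piY_additive : zmod_morphism piY.
Proof.
by move=> x y; rewrite /piY -[RHS]/(yadd _ (yopp _)) !piE.
Qed.
Fact piY_multiplicative : monoid_morphism piY.
Proof.
split=> [|x y]; rewrite /piY.
  by rewrite -[RHS]/(yone q R) !piE.
by rewrite -[RHS]/(ymul _ _) !piE.
Qed.
HB.instance Definition _ := GRing.isZmodMorphism.Build free Y piY piY_additive.
HB.instance Definition _ := GRing.isMonoidMorphism.Build free Y piY piY_multiplicative.

Lemma piYZ c x : piY (c *: x) = c *: piY x.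
Proof. by rewrite /piY -[RHS]/(yscale c _) !piE. Qed.

Lemma piY_ideal x : rtt_ideal q R x -> piY x = 0.
Proof.
move=> hx; rewrite -[RHS](rmorph0 piY); apply/eqP/yangian_eqP.
by rewrite subr0.
Qed.

Lemma yangian_rtt k l : rtt_coef q R (yangian_T q R) k l = 0.
Proof.
have fZ c : piY c%:A = c%:A by rewrite piYZ rmorph1.
have -> : yangian_T q R = (fun k => map_mx piY (free_T k)).
  by apply/funext => k'; apply/matrixP => i j; rewrite !mxE.
have <- := rtt_coef_map q R fZ (@free_T K N) k l.
apply/matrixP => a b; rewrite [LHS]mxE [RHS]mxE.
by apply: piY_ideal; apply: rtt_rel.
Qed.

(** Commuting with x is stable under sums, products and scalars, and the images of the words in the
    generators span the Yangian. *)
Lemma yangian_ind (x : Y) : (forall k i j, GRing.comm x (yangian_T q R k i j)) ->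
  central x.
Proof.
move=> hx y.
have -> : y = piY (repr y) by rewrite /piY reprK.
rewrite [repr y]monalgE rmorph_sum; apply: commr_sum => mon _ /=.
have -> : << (repr y)@_mon *g mon >> = (repr y)@_mon *: << mon >> :> free.
  by rewrite -mul_malgC malgM_def fgmulUU mulr1 mul1m.
rewrite piYZ -mulr_algl; apply: commrM.
  by rewrite /GRing.comm mulr_algl mulr_algr.
case: mon => s; elim: s => [|[[k i] j] s IHs].
  have -> : << FMonom [::] >> = 1 :> free by rewrite -fmoneE.
  by rewrite rmorph1; apply: commr1.
have -> : << FMonom ((k, i, j) :: s) >> = << fmu (k, i, j) >> * << FMonom s >> :> free.
  have E : FMonom ((k, i, j) :: s) = mmul (fmu (k, i, j)) (FMonom s).
    by apply: val_inj; rewrite /= fmM fmU.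
  by rewrite malgM_def fgmulUU mulr1 E.
rewrite (rmorphM piY); apply: commrM; last exact: IHs.
by have := hx k i j; rewrite !mxE.
Qed.

Section Evaluation.

Variables (A : algType K) (T : nat -> 'M[A]_N).
Hypothesis hT : forall k l, rtt_coef q R T k l = 0.

Definition eval_mon (mon : {fmonom (nat * 'I_N * 'I_N)%type}) : A :=
  \prod_(x <- (mon : seq _)) T x.1.1 x.1.2 x.2.

Fact eval_mon_morph : mmorphism eval_mon.
Proof.
by split=> [x y|]; rewrite /eval_mon ?fmM ?big_cat // fm1 big_nil.
Qed.
HB.instance Definition _ := isMultiplicative.Build _ _ eval_mon eval_mon_morph.

Definition eval_free : free -> A := mmap (in_alg A) eval_mon.

Fact eval_free_additive : zmod_morphism eval_free.
Proof. by move=> x y; apply: (raddfB (mmap (in_alg A) eval_mon)). Qed.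
Fact eval_free_multiplicative : monoid_morphism eval_free.
Proof.
have [hM h1] := @commr_mmap_is_multiplicative _ _ _ (in_alg A) eval_mon
  (fun g mo mo' => in_algC (g@_mo) (eval_mon mo')).
by split.
Qed.
HB.instance Definition _ := GRing.isZmodMorphism.Build free A eval_free eval_free_additive.
HB.instance Definition _ :=
  GRing.isMonoidMorphism.Build free A eval_free eval_free_multiplicative.

Lemma eval_freeZ c : eval_free c%:A = c%:A.
Proof. by rewrite /eval_free (mmapZ (f := in_alg A)) mmap1 mulr1. Qed.

Lemma eval_free_T k : map_mx eval_free (free_T k) = T k.
Proof.
apply/matrixP => i j; rewrite !mxE /eval_free (mmapU (f := in_alg A)) /= scale1r mul1r.
by rewrite /eval_mon fmU big_seq1.
Qed.

Lemma eval_ideal x : rtt_ideal q R x -> eval_free x = 0.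
Proof.
elim=> [k l a b||y z _ Hy _ Hz|z y _ Hy|z y _ Hy].
- have := rtt_coef_map q R eval_freeZ (@free_T K N) k l.
  move=> /matrixP /(_ a b); rewrite [LHS]mxE => ->.
  have -> : (fun k => map_mx eval_free (free_T k)) = T.
    by apply/funext => k'; apply: eval_free_T.
  by rewrite hT [LHS]mxE.
- exact: rmorph0.
- by rewrite (rmorphD eval_free) /= Hy Hz addr0.
- by rewrite (rmorphM eval_free) /= Hy mulr0.
- by rewrite (rmorphM eval_free) /= Hy mul0r.
Qed.

(** The choice of the representative is immaterial, because [eval_free] vanishes on the RTT
    ideal. *)
Definition eval_yangian (x : Y) : A := eval_free (repr x).

Lemma eval_piY x : eval_yangian (piY x) = eval_free x.
Proof.
apply/eqP; rewrite -subr_eq0 -(rmorphB eval_free); apply/eqP; apply: eval_ideal.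
by apply/yangian_eqP; rewrite reprK.
Qed.

Fact eval_yangian_additive : zmod_morphism eval_yangian.
Proof.
move=> x y; rewrite -[x]reprK -[y]reprK -!/(piY _) -(rmorphB piY) !eval_piY.
exact: (rmorphB eval_free).
Qed.
Fact eval_yangian_multiplicative : monoid_morphism eval_yangian.
Proof.
split=> [|x y]; first by rewrite -(rmorph1 piY) eval_piY (rmorph1 eval_free).
rewrite -[x]reprK -[y]reprK -!/(piY _) -(rmorphM piY) !eval_piY.
exact: (rmorphM eval_free).
Qed.
HB.instance Definition _ :=
  GRing.isZmodMorphism.Build Y A eval_yangian eval_yangian_additive.
HB.instance Definition _ :=
  GRing.isMonoidMorphism.Build Y A eval_yangian eval_yangian_multiplicative.

Lemma yangian_eval : exists f : {rmorphism Y -> A},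
  (forall c, f c%:A = c%:A) /\ forall k, map_mx f (yangian_T q R k) = T k.
Proof.
exists eval_yangian; split=> [c|k].
  by rewrite -(rmorph1 piY) -piYZ; etransitivity; [apply: eval_piY | apply: eval_freeZ].
apply/matrixP => i j; rewrite -eval_free_T [LHS]mxE [RHS]mxE.
by etransitivity; [|apply: eval_piY]; rewrite mxE.
Qed.

End Evaluation.

End Yangian.

(* The coefficients of R^-1 - u^-1 R, r - h standing for R^-1. *)
Definition Lop (V : zmodType) (h r : V) k : V :=
  match k with 0 => r - h | 1 => - r | _ => 0 end.

(** * The evaluation representation *)

Section EvaluationRing.

Variables (H : pzRingType) (h b c : H).
Hypothesis hC : central h.
Hypothesis hb : (b - h) * b = 1.
Hypothesis hb' : b * (b - h) = 1.
Hypothesis hc : (c - h) * c = 1.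
Hypothesis hc' : c * (c - h) = 1.
Hypothesis bcb : b * c * b = c * b * c.

Local Notation a k l := (Lop h b k * Lop h c l).

(** Every nontrivial case is the braid relation with some letters inverted: b - h and c - h are the
    inverses of b and c, and where the sums in h do not cancel they replace an outer letter by its
    inverse. *)
Lemma Lop_rtt k l :
  c * a k l - h * (\sum_(r < k.+1) a (k - r)%N (l + r)%N)
  - (a l k * b - h * (\sum_(r < k.+1) a (l + r)%N (k - r)%N)) = 0.
Proof.
have bK x y : b * x = b * y -> x = y.
  by move=> /(congr1 (fun z => (b - h) * z)); rewrite !mulrA hb !mul1r.
have cK x y : c * x = c * y -> x = y.
  by move=> /(congr1 (fun z => (c - h) * z)); rewrite !mulrA hc !mul1r.
(* In total degree at least 2 a product of two coefficients is nonzero only for the indices (1, 1).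
   Exchanging the indices thus does not change the terms, and the two sums agree. *)
have [kl | kl] := leqP 2 (k + l).
  have -> : \sum_(r < k.+1) a (l + r)%N (k - r)%N = \sum_(r < k.+1) a (k - r)%N (l + r)%N.
    apply: eq_bigr => r _; have xy : ((l + r) + (k - r) = k + l)%N.
      by have := ltn_ord r; lia.
    case: (l + r)%N xy => [|[|x]]; case: (k - r)%N => [|[|y]] xy //=;
      by rewrite ?mul0r ?mulr0 //; exfalso; lia.
  suff -> : c * a k l = a l k * b by rewrite subrr.
  case: k l kl => [|[|k]] [|[|l]] //= _; rewrite ?mul0r ?mulr0 ?mul0r //.
  by rewrite !mulrNN mulrA bcb.
have redl x : c * x - h * x = (c - h) * x by rewrite mulrBl.
have redr x : x * b - h * x = x * (b - h) by rewrite mulrBr (hC x).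
case: k l kl => [|[|k]] [|[|l]] //= _; rewrite ?big_ord_recl ?big_ord0 /= ?addr0.
- rewrite redl redr; move: hb hb' hc hc' bK cK.
  move: (b - h) (c - h) => sb sc eb eb' ec ec' bK cK; apply/eqP.
  rewrite subr_eq0; apply/eqP/bK/cK/bK.
  have -> : b * (c * (b * (sc * (sb * sc)))) = 1.
    by rewrite (mulrA b c) (mulrA (b * c)) bcb -!mulrA (mulrA c sc) ec' mul1r
      (mulrA b sb) eb' mul1r ec'.
  by rewrite -!mulrA (mulrA b sb) eb' mul1r (mulrA c sc) ec' mul1r eb'.
- rewrite redl redr !(mulrN, mulNr) opprK addrC; apply/eqP; rewrite subr_eq0.
  move: hb hb' hc hc' bK cK.
  move: (b - h) (c - h) => sb sc eb eb' ec ec' bK cK; apply/eqP.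
  apply/cK/bK; rewrite !mulrA -(mulrA b c) -!mulrA.
  rewrite (mulrA c sc) ec' mul1r (mulrA b sb) eb' mul1r.
  by rewrite (mulrA b c) (mulrA (b * c)) bcb -!mulrA (mulrA c sc) ec' mul1r eb' mulr1.
- rewrite (addrC ((b - h) * _)) opprB addrA subrK !(mulrN, mulNr) opprK addrC.
  apply/eqP; rewrite subr_eq0.
  move: hb hb' hc hc' bK cK.
  move: (b - h) (c - h) => sb sc eb eb' ec ec' bK cK; apply/eqP.
  apply/bK; rewrite -!mulrA (mulrA b sb) eb' mul1r.
  by rewrite (mulrA b c) (mulrA (b * c)) bcb -!mulrA ec' mulr1.
Qed.

End EvaluationRing.

Section Triples.

Variables (K : fieldType) (N : nat).

Lemma sum_pair (V : nmodType) (F : 2.-tuple 'I_N -> V) :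
  \sum_I F I = \sum_x \sum_y F [tuple x; y].
Proof.
rewrite pair_big /= (reindex (fun p => [tuple p.1; p.2])) //=.
exists (fun I => (tnth I ord0, tnth I ord_max)) => [[x y] _|I _] //=.
apply: eq_from_tnth => i; case: i => -[|[|//]] i;
  rewrite [LHS](tnth_nth (tnth I ord0)) /=; congr tnth; exact: val_inj.
Qed.

(** X composed with the flip: the representation space enters X as its first factor and leaves as
    its second. *)
Definition legop (X : tensor_op K N 2) : 'M['M[K]_N]_N :=
  \matrix_(i, j) \matrix_(s, t) coef X [tuple s; i] [tuple j; t].

Lemma coef_place12 (A : pzSemiRingType) (X Y : 'M[A]_N) i j k l :
  coef (place1 ord0 X *m place1 ord_max Y) [tuple i; j] [tuple k; l] = X i k * Y j l.
Proof.
have ct x y : [tuple x; y] = cons_tuple x [tuple y] :> 2.-tuple 'I_N by apply: val_inj.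
have rt x y : [tuple x; y] = rcons_tuple [tuple x] y :> 2.-tuple 'I_N by apply: val_inj.
rewrite coefM sum_pair (bigD1 k) //= [X in _ + X]big1 ?addr0 => [|x /negPf xk]; last first.
  apply: big1 => y _; rewrite [X in _ * coef _ X _]rt (rt k l) coef_place1_max.
  rewrite (_ : ([tuple x] == [tuple k]) = false) ?mulr0 //.
  by apply/negbTE; apply/eqP => /(congr1 val) [xk']; rewrite xk' eqxx in xk.
rewrite (bigD1 j) //= [X in _ + X]big1 ?addr0 => [|y /negPf yj]; last first.
  rewrite !ct coef_place1_0 (_ : ([tuple j] == [tuple y]) = false) ?mul0r //.
  by apply/negbTE; apply/eqP => /(congr1 val) [yj']; rewrite yj' eqxx in yj.
rewrite (ct i j) {1}(ct k j) coef_place1_0 eqxx.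
by rewrite (rt k j) (rt k l) coef_place1_max eqxx.
Qed.

Lemma coef_adj01 (Y Z : tensor_op K N 2) s i j k l t :
  coef (adj 2 0 Y *m adj 2 1 Z) (cons_tuple s [tuple i; j]) (rcons_tuple [tuple k; l] t)
    = \sum_e coef Y [tuple s; i] [tuple k; e] * coef Z [tuple e; j] [tuple l; t].
Proof.
have cr x y z : cons_tuple x [tuple y; z] = rcons_tuple [tuple x; y] z :> 3.-tuple 'I_N.
  by apply: val_inj.
rewrite !adj_shift coefM sum_rcons sum_pair (bigD1 k) //= [X in _ + X]big1 ?addr0; last first.
  move=> x /negPf xk; apply: big1 => e _; apply: big1 => z _.
  by rewrite -!cr coef_place_tail xk mulr0.
apply: eq_bigr => e _; rewrite (bigD1 j) //= big1 ?addr0 => [|z /negPf zj]; last first.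
  by rewrite cr coef_place_init eq_sym zj mul0r.
by rewrite (cr s i j) coef_place_init eqxx -(cr k e j) -(cr k l t) coef_place_tail (eqxx k).
Qed.

Lemma coef_adj1M (X : tensor_op K N 2) (W : tensor_op K N 3) s I b :
  coef (adj 2 1 X *m W) (cons_tuple s I) b = \sum_J coef X I J * coef W (cons_tuple s J) b.
Proof.
rewrite adj_shift coefM sum_cons (bigD1 s) //= [X in _ + X]big1 ?addr0 => [|x /negPf xs]; last first.
  by apply: big1 => J _; rewrite coef_place_tail eq_sym xs mul0r.
by apply: eq_bigr => J _; rewrite coef_place_tail eqxx.
Qed.

Lemma coef_Madj0 (X : tensor_op K N 2) (W : tensor_op K N 3) a J t :
  coef (W *m adj 2 0 X) a (rcons_tuple J t) = \sum_I coef W a (rcons_tuple I t) * coef X I J.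
Proof.
rewrite adj_shift coefM sum_rcons; apply: eq_bigr => I _.
rewrite (bigD1 t) //= big1 ?addr0 => [|x /negPf xt]; first by rewrite coef_place_init eqxx.
by rewrite coef_place_init xt mulr0.
Qed.

End Triples.

Section EvaluationRepresentation.

Variables (K : fieldType) (N' : nat) (q : K).
Local Notation N := N'.+1.
Variable R : tensor_op K N 2.
Hypothesis hq : generic q.
Hypothesis hR : hecke_symmetry q R.

Local Notation A := 'M[K]_N'.+1.
Local Notation h := ((q - q^-1)%:M : tensor_op K N 2).

Definition evalT k : 'M[A]_N := legop (Lop h R k).

(** Along two legs the representation space enters at the first of three factors and leaves at the
    last. Thus R multiplied on the left acts as [adj 2 1 R], on the right as [adj 2 0 R], and the
    RTT relation becomes an identity of braid type. *)
Definition leg_rel (W : tensor_op A N 2) (V : tensor_op K N 3) :=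
  forall s I J t, coef W I J s t = coef V (cons_tuple s I) (rcons_tuple J t).

Lemma leg_relP W : leg_rel W 0 -> W = 0.
Proof.
move=> hW; apply: tensor_eqP => I J; apply/matrixP => s t.
by rewrite hW /coef !mxE.
Qed.

Lemma leg_relD W W' V V' : leg_rel W V -> leg_rel W' V' -> leg_rel (W + W') (V + V').
Proof. by move=> h1 h2 s I J t; rewrite !coefD mxE h1 h2. Qed.

Lemma leg_relN W V : leg_rel W V -> leg_rel (- W) (- V).
Proof. by move=> h1 s I J t; rewrite !coefN mxE h1. Qed.

Lemma leg_rel0 : leg_rel 0 0.
Proof. by move=> s I J t; rewrite /coef !mxE. Qed.

Lemma leg_rel_sum n (F : 'I_n -> tensor_op A N 2) G :
  (forall i, leg_rel (F i) (G i)) -> leg_rel (\sum_i F i) (\sum_i G i).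
Proof.
move=> FG; elim/big_rec2: _ => [|i y x _ xy]; first exact: leg_rel0.
exact: leg_relD.
Qed.

Lemma leg_relZ c W V : leg_rel W V -> leg_rel (c%:A *: W) (c%:M *m V).
Proof.
by move=> h1 s I J t; rewrite mul_scalar_mx !coefZ -h1 mulr_algl mxE.
Qed.

Lemma leg_rel_base X Y :
  leg_rel (place1 ord0 (legop X) *m place1 ord_max (legop Y)) (adj 2 0 X *m adj 2 1 Y).
Proof.
move=> s I J t.
have pE (L : 2.-tuple 'I_N) : L = [tuple tnth L ord0; tnth L ord_max].
  apply: eq_from_tnth => i; case: i => -[|[|//]] i;
    rewrite [RHS](tnth_nth ord0) /=; congr tnth; exact: val_inj.
rewrite (pE I) (pE J) coef_place12 coef_adj01 !mxE; apply: eq_bigr => e _.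
by rewrite !mxE.
Qed.

Lemma leg_relMl X W V : leg_rel W V -> leg_rel (scal_mx X *m W) (adj 2 1 X *m V).
Proof.
move=> h1 s I J t; rewrite coef_adj1M coefM summxE; apply: eq_bigr => L _.
by rewrite coef_map mulr_algl mxE h1.
Qed.

Lemma leg_relMr X W V : leg_rel W V -> leg_rel (W *m scal_mx X) (V *m adj 2 0 X).
Proof.
move=> h1 s I J t; rewrite coef_Madj0 coefM summxE; apply: eq_bigr => L _.
by rewrite coef_map mulr_algr mxE h1 mulrC.
Qed.

Lemma evalT_rtt k l : rtt_coef q R evalT k l = 0.
Proof.
have q0 := generic_neq0 hq; case: (hR) => bcb hQ.
apply: leg_relP; pose b := adj 2 0 R; pose c := adj 2 1 R.
pose H := (q - q^-1)%:M : tensor_op K N 3.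
pose a k l : tensor_op K N 3 := Lop H b k *m Lop H c l.
have L0 x : adj 2 0 (Lop h R x) = Lop H b x.
  by case: x => [|[|x]]; rewrite /adj /= ?placeD ?placeN ?place_scalar ?place0.
have L1 x : adj 2 1 (Lop h R x) = Lop H c x.
  by case: x => [|[|x]]; rewrite /adj /= ?placeD ?placeN ?place_scalar ?place0.
have aR x y : leg_rel (place1 ord0 (evalT x) *m place1 ord_max (evalT y)) (a x y).
  by rewrite /a -L0 -L1; apply: leg_rel_base.
have kC x : central (x%:M : tensor_op K N 3) by move=> y; apply/esym/scalar_mxC.
have inv j : (j < 2)%N -> adj 2 j R * (adj 2 j R - H) = 1
    /\ (adj 2 j R - H) * adj 2 j R = 1.
  move=> j2; have [/(_ j j2) eQ _ _] := egen_hecke hq hR 2.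
  have jE : adj 2 j R = egen q R 2 j - q^-1%:M by rewrite /egen addrK.
  have jhE : adj 2 j R - H = egen q R 2 j - q%:M.
    by rewrite jE /H raddfB /= opprB addrA subrK.
  (* As e^2 = (x + y) e, the product (e - x) (e - y) is xy. With q and q^-1 in either order, it
     shows that R - (q - q^-1) is a two-sided inverse of R. *)
  have pq x y : x * y = 1 -> x + y = q + q^-1 ->
      (egen q R 2 j - x%:M) * (egen q R 2 j - y%:M) = 1.
    move=> xy1 xys; have Et : egen q R 2 j * egen q R 2 j
        = (x%:M + y%:M) * egen q R 2 j.
      by rewrite eQ -xys; congr (_ * _); apply: raddfD.
    rewrite mulrBl !mulrBr Et -(kC y) -[x%:M * y%:M]scalar_mxM xy1.
    by rewrite mulrDl addrK opprB addrC subrK.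
  rewrite jhE jE; split; apply: pq; rewrite ?mulVf ?mulfV //.
  exact: addrC.
have [b1 b2] := inv 0%N isT; have [c1 c2] := inv 1%N isT.
have lr := Lop_rtt (kC _) b2 b1 c2 c1 bcb k l.
rewrite -[X in leg_rel _ X]lr /rtt_coef -mulmxA.
apply: leg_relD; last apply: leg_relN; apply: leg_relD.
- exact: leg_relMl.
- apply/leg_relN/leg_relZ/leg_rel_sum => i; exact: aR.
- exact: leg_relMr.
- apply/leg_relN/leg_relZ/leg_rel_sum => i; exact: aR.
Qed.

(* T[0] + T[1] is minus (q - q^-1) times the flip. *)
Lemma evalT_scalar (M : 'M[K]_N) :
  (forall k i j, \sum_s (M i s)%:A * evalT k s j = \sum_s evalT k i s * (M s j)%:A) ->
  is_scalar_mx M.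
Proof.
move=> hM; have h0 := generic_hneq0 hq.
have hS i j : \sum_s (M i s)%:A * (evalT 0 s j + evalT 1 s j)
    = \sum_s (evalT 0 i s + evalT 1 i s) * (M s j)%:A.
  under eq_bigr => s _ do rewrite mulrDr; rewrite big_split /= !hM -big_split /=.
  by apply: eq_bigr => s _; rewrite mulrDl.
have E i j s t : (evalT 0 i j + evalT 1 i j) s t = - (q - q^-1) *+ ((s == j) && (i == t)).
  rewrite !mxE -coefD /Lop addrAC subrr sub0r coefN coef_scalar.
  rewrite mulNrn; congr (- (_ *+ nat_of_bool _)).
  by apply/eqP/andP => [/(congr1 val) [-> ->] | [/eqP -> /eqP ->]].
have {}hS i j s t : M i t *+ (s == j) = M s j *+ (i == t).
  have := congr1 (fun X : A => X s t) (hS i j); rewrite !summxE.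
  rewrite (bigD1 t) //= mulr_algl mxE E eqxx andbT big1 ?addr0 => [|x /negPf xt]; last first.
    by rewrite mulr_algl mxE E xt andbF mulr0.
  rewrite (bigD1 s) //= mulr_algr mxE E eqxx big1 ?addr0 => [|x /negPf xs]; last first.
    by rewrite mulr_algr mxE E eq_sym xs mulr0.
  rewrite !mulrnAr -!mulrnAl; apply: mulIf; by rewrite oppr_eq0.
apply/is_scalar_mxP; exists (M ord0 ord0); apply/matrixP => i t.
by have := hS i ord0 ord0 t; rewrite eqxx mulr1n mxE.
Qed.

End EvaluationRepresentation.

Lemma coef_place1_single (A : nmodType) N (X : 'M[A]_N) (a b : 1.-tuple 'I_N) :
  coef (place1 ord0 X) a b = X (tnth a ord0) (tnth b ord0).
Proof.
rewrite coef_place1; case: ifP => // /negP[]; apply/agreeP => l.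
by rewrite inE [l]ord1.
Qed.

Lemma place1_single (A : nmodType) N n (k : 'I_n) (X : 'M[A]_N) :
  place1 k X = place [tuple k] (place1 (ord0 : 'I_1) X).
Proof. by rewrite place_place1. Qed.

Lemma place1_mul (A : pzSemiRingType) N n (k : 'I_n) (X Y : 'M[A]_N) :
  place1 k X *m place1 k Y = place1 k (X *m Y).
Proof.
rewrite !(place1_single k) -placeM //; congr place; apply: tensor_eqP => a b.
rewrite coefM coef_place1_single mxE (reindex (fun i => [tuple i])) /=.
  by apply: eq_bigr => s _; rewrite !coef_place1_single.
exists (fun c : 1.-tuple 'I_N => tnth c ord0) => // c _.
by apply: eq_from_tnth => z; rewrite [z]ord1.
Qed.

Lemma place1_scalar (A : pzSemiRingType) N n (k : 'I_n) :
  place1 k (1%:M : 'M[A]_N) = 1%:M.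
Proof.
rewrite place1_single -(@place_scalar N A _ _ [tuple k] 1).
congr place; apply: tensor_eqP => a b; rewrite coef_place1_single mxE coef_scalar.
congr (_ *+ nat_of_bool _); apply/eqP/eqP => [ab|-> //].
by apply: eq_from_tnth => z; rewrite [z]ord1.
Qed.

(** * Centrality of the determinant and scalarity of M *)

Section QdetUnit.

Variables (K : fieldType) (N m : nat) (q : K) (R : tensor_op K N 2).
Variables (u v : m.+1.-tuple 'I_N -> K).
Hypothesis hq : generic q.
Hypothesis hR : hecke_symmetry q R.
Hypothesis Pm0 : skew_symmetrizer q R m.+1 <> 0.
Hypothesis huv : forall a b, coef (skew_symmetrizer q R m.+1) a b = u a * v b.

(** In degree 0 the product of the T's has a right inverse W, assembled from X in each factor. So P
    = D_0 P W, and a nonzero entry u_I v_J of P yields a right inverse of D_0. *)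
Lemma qdet0_unit (A : algType K) (T : nat -> 'M[A]_N) (X : 'M[A]_N) :
  (forall k l, rtt_coef q R T k l = 0) -> T 0 *m X = 1%:M ->
  exists w, qdet q T u v 0 * w = 1.
Proof.
move=> hT TX; have [I [J uv0]] := uv_neq0 Pm0 huv.
have T0 : Tprod q T m.+1 0 = \prod_(i < m.+1) place1 i (T 0).
  rewrite /Tprod (big_pred1 [ffun=> ord0]) => [|d] /=; last first.
    rewrite sum_nat_eq0; apply/forallP/eqP => [d0|-> i]; last by rewrite ffunE.
    by apply/ffunP => i; rewrite ffunE; apply: val_inj; apply/eqP; apply: d0.
  by apply: eq_bigr => i _; rewrite ffunE muln0 expr0 !scale1r.
have [W TW] : exists W, Tprod q T m.+1 0 *m W = 1%:M.
  rewrite T0; elim/big_rec: _ => [|i L _ [W LW]]; first by exists 1; apply: mulmx1.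
  exists (W *m place1 i X).
  rewrite -[LHS]/((_ *m _) *m _) mulmxA -(mulmxA _ L) LW mulmx1 place1_mul TX.
  exact: place1_scalar.
have := congr1 (fun Z => coef (Z *m W) I J) (Tprod_qdet hq hR hT huv 0).
rewrite -mulmxA TW mulmx1 -scalemxAl coefZ coef_map huv => E.
exists (coef (scal_mx (skew_symmetrizer q R m.+1) *m W) I J * (u I * v J)^-1%:A).
by rewrite mulrA -E -(rmorphM (in_alg A)) mulfV // rmorph1.
Qed.

End QdetUnit.

Section Centrality.

Variables (K : fieldType) (N m : nat) (q : K) (R : tensor_op K N 2).
Variables (u v : m.+1.-tuple 'I_N -> K).
Hypothesis hq : generic q.
Hypothesis hR : hecke_symmetry q R.
Hypothesis Pm0 : skew_symmetrizer q R m.+1 <> 0.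
Hypothesis huv : forall a b, coef (skew_symmetrizer q R m.+1) a b = u a * v b.
Hypothesis Pm2 : skew_symmetrizer q R m.+2 = 0.
Local Notation M := (contraction u v).

Lemma central_qdet_scalar :
  (forall k, central (qdet q (yangian_T q R) u v k)) -> is_scalar_mx M.
Proof.
move=> hD; have [I _] := uv_neq0 Pm0 huv.
case: N R u v hR Pm0 huv Pm2 hD I => [|N'] R' u' v' hR' Pm0' huv' Pm2' hD I.
  by case: (thead I).
have hT := evalT_rtt hq hR'; have [f [fZ fT]] := yangian_eval hT.
apply: (evalT_scalar hq (R := R')) => k i j.
set T := evalT q R' in hT fT *; pose d := qdet q T u' v' 0.
have dC l a b : d * T l a b = T l a b * d.
  have TE : (fun k => map_mx f (yangian_T q R' k)) = T by apply/funext.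
  have -> : d = f (qdet q (yangian_T q R') u' v' 0) by rewrite (qdet_map q fZ) TE.
  by rewrite -fT mxE -!rmorphM hD.
(* The entries of R are arranged so that the sums over both matrix levels form R^-1 R. *)
have TX : T 0 *m (\matrix_(a, b) \matrix_(s, t) coef R' [tuple a; s] [tuple t; b]) = 1%:M.
  apply/matrixP => a b; rewrite !mxE; apply/matrixP => s t; rewrite summxE.
  have RR : (R' - (q - q^-1)%:M) *m R' = 1%:M.
    case: hR' => _; rewrite mulmxDr !mulmxBl.
    rewrite -scalar_mxM mulfV ?(generic_neq0 hq) // scalar_mxC -addrA => /eqP.
    rewrite addr_eq0 => /eqP ->; rewrite raddfB mulmxBl /= opprB.
    by rewrite opprD opprK opprB addrCA.
  have := congr1 (fun Z => coef Z [tuple s; a] [tuple t; b]) RR.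
  rewrite coefM coef_scalar sum_pair => E.
  transitivity (([tuple s; a] == [tuple t; b])%:R : K).
    rewrite -[RHS]E; apply: eq_bigr => x _; rewrite mxE; apply: eq_bigr => y _.
    by rewrite !mxE.
  have -> : ([tuple s; a] == [tuple t; b]) = (s == t) && (a == b).
    by apply/eqP/andP => [/(congr1 val) [-> ->]|[/eqP -> /eqP ->]].
  by case: (a == b); rewrite ?andbT ?andbF mxE.
have [w dw] := qdet0_unit hq hR' Pm0' huv' hT TX.
(* The image of D_0 is a square matrix over K, so its right inverse is also a left inverse and d can
   be cancelled. *)
have wd : w * d = 1 by apply: mulmx1C.
have dI (x y : 'M[K]_N'.+1) : d * x = d * y -> x = y.
  by move=> /(congr1 ( *%R w)); rewrite !mulrA wd !mul1r.
apply: dI; etransitivity; first exact: (qdet_contraction hq hR' Pm2' Pm0' huv' hT).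
rewrite big_distrl big_distrr; apply: eq_bigr => s _ /=.
by rewrite mulrA dC -!mulrA in_algC.
Qed.

Lemma scalar_qdet_central :
  is_scalar_mx M -> forall k, central (qdet q (yangian_T q R) u v k).
Proof.
move=> /is_scalar_mxP[c Mc] k; apply: yangian_ind => l i j.
have c0 : c != 0.
  apply/eqP => c0; have := contraction_neq0 hq hR Pm2 Pm0 huv.
  by rewrite Mc c0 raddf0 eqxx.
have := qdet_contraction hq hR Pm2 Pm0 huv (yangian_rtt q R) k l i j.
rewrite (bigD1 i) //= [X in _ * (_ + X)]big1 ?addr0 => [|s /negPf si]; last first.
  by rewrite Mc [c%:M _ _]mxE eq_sym si scale0r mul0r.
rewrite (bigD1 j) //= [X in (_ + X) * _]big1 ?addr0 => [|s /negPf sj]; last first.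
  by rewrite Mc [c%:M _ _]mxE sj scale0r mulr0.
rewrite Mc ![c%:M _ _]mxE !eqxx mulr_algl mulr_algr -scalerAr -scalerAl.
exact: scalerI.
Qed.

End Centrality.

Theorem mainTheorem2
  (F : realType) (K : fieldType)
  (hK : K = F :> fieldType \/ K = F[i] :> fieldType)
  (N m : nat) (q : K) (R Psi : tensor_op K N 2) (u v : m.-tuple 'I_N -> K)
  (hq : generic q)
  (hR : hecke_symmetry q R)
  (hPsi : skew_inverse R Psi)
  (hm : (2 <= m)%N)
  (heven : even_birank q R m)
  (huv : rank_one_factors q R u v) :
  (forall n : nat, central (det_coef q R Psi (yangian_T q R) m n))
  <-> is_scalar_mx (Nmx q u v).
Proof.
case: m u v hm heven huv => // m u v _ heven [huv _].
have [Pm0 Pm2] := heven; have {}Pm2 := Pm2 _ (ltnSn m.+1).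
have tP := rtrace_antisym_neq0 hq hR hPsi (ltn0Sn m) heven.
have detE n := det_coef_qdet hq hR huv (yangian_rtt q R) Psi n.
have c0 : (-1) ^+ m * q * qnum q m.+1 != 0.
  apply: mulf_neq0; last exact: qnum_neq0.
  by rewrite mulf_neq0 ?signr_eq0 ?(generic_neq0 hq).
have scal : is_scalar_mx (Nmx q u v) <-> is_scalar_mx (contraction u v).
  rewrite NmxE; split=> /is_scalar_mxP[c E]; apply/is_scalar_mxP.
    exists (((-1) ^+ m * q * qnum q m.+1)^-1 * c).
    by rewrite -scale_scalar_mx -E scalerA mulVf // scale1r.
  by exists ((-1) ^+ m * q * qnum q m.+1 * c); rewrite E scale_scalar_mx.
split=> [hD | /scal hM n y].
  apply/scal/(central_qdet_scalar hq hR Pm0 huv Pm2) => k y.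
  have := hD k y; rewrite /GRing.comm detE -scalerAl -scalerAr.
  exact: scalerI.
rewrite /GRing.comm detE -scalerAl -scalerAr; congr (_ *: _).
exact: (scalar_qdet_central hq hR Pm0 huv Pm2 hM).
Qed.
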